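(* Let $p$ be an odd prime and $q = 3^p$. Then $|\mathrm{Solv}(\mathrm{PSL}(2, q))| = \frac{4q^2 - q + 1}{2}$.
   Context: For a finite group $G$ and $x \in G$, the solvabilizer of $x$ in $G$ is $\mathrm{Sol}_G(x) = \{y \in G : \langle x, y \rangle \text{ is solvable}\}$. $\mathrm{Solv}(G) = \{\mathrm{Sol}_G(x) : x \in G\}$ is the set of distinct solvabilizers of elements of $G$, and $|\mathrm{Solv}(G)|$ is its cardinality. *)

(* Defs.v *)
From HB Require Import structures.
From mathcomp Require Import all_boot all_order all_algebra all_fingroup all_solvable.
From mathcomp Require Import matrix finalg.
Set Implicit Arguments. Unset Strict Implicit. Unset Printing Implicit Defensive.
Import GRing.Theory.
Local Open Scope group_scope.

Definition solvabilizer (gT : finGroupType) (G : {set gT}) (x : gT) : {set gT} :=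
  [set y in G | solvable <<[set x; y]>>].

Definition Solv (gT : finGroupType) (G : {set gT}) : {set {set gT}} :=
  [set solvabilizer G x | x in G].

Definition SL2_set (F : finFieldType) : {set {'GL_2[F]}} :=
  [set g : {'GL_2[F]} | (\det (GLval g) == 1)%R].

Lemma SL2_group_set (F : finFieldType) : group_set (SL2_set F).
Proof.
apply/group_setP; split; first by rewrite inE GL_1E det1.
move=> g h; rewrite !inE GL_MxE det_mulmx => /eqP -> /eqP ->.
by rewrite mulr1.
Qed.

Canonical SL2 (F : finFieldType) : {group {'GL_2[F]}} := Group (SL2_group_set F).

Definition PSL2 (F : finFieldType) := (SL2 F / 'Z(SL2 F))%G.

(* Main.v *)
Require Import Defs.
From mathcomp Require Import all_boot all_order all_algebra all_fingroup all_solvable.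
From mathcomp Require Import matrix finalg.
From mathcomp Require Import finfield.
From mathcomp Require Import ring zify.
Set Implicit Arguments. Unset Strict Implicit. Unset Printing Implicit Defensive.
Import GRing.Theory.

(** The center being solvable, one may work in SL(2,q), q = 3 ^ p, where -1 is not a
square. Let H be a nonscalar solvable subgroup and A its last nonscalar derived
subgroup, so that commutators in A are 1 or -1. If A is abelian, then H normalizes
the line spanned by a traceless matrix M commuting with A: H fixes a point of the
projective line (det M = 0) or normalizes a torus. Otherwise A is a quaternion group,
and averaging over it shows that all traces of elements of H lie in the prime field.

Hence Sol(x) is everything for x scalar; it depends only on the torus F + F M of x
when tr x is not in the prime field; and when x = 1 + P is unipotent, resp. x = J is an
involution modulo the center, it can be told apart from the others by means of the
rule: <1 + P, J> is solvable iff tr (P J) = 1 or -1. All solvabilizers are thus labelled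
by traceless matrices M up to sign with det M in {0, 1, -1}, where the M with det M = 1
are used twice, for the involution M and for its torus. The fibres of
M |-> det M have q ^ 2, q ^ 2 - q and q ^ 2 + q elements at 0, 1 and -1. *)

(** * Two-by-two matrices *)

Section TwoByTwo.
Local Open Scope ring_scope.
Variable F : fieldType.
Implicit Types (A B M N P X : 'M[F]_2) (a b c d k : F).

Definition mx2 a b c d : 'M[F]_2 :=
  \matrix_(i, j) if i == 0 then if j == 0 then a else b
                 else if j == 0 then c else d.

Lemma ord2E (i : 'I_2) : i = if i == 0 then 0 else 1.
Proof. by apply: val_inj; case: i => [[|[|]]]. Qed.

Lemma mx2P A : exists a b c d, A = mx2 a b c d.
Proof.
exists (A 0 0), (A 0 1), (A 1 0), (A 1 1); apply/matrixP => i j.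
by rewrite mxE (ord2E i) (ord2E j); do 2 case: ifP.
Qed.

Lemma mx2_inj a b c d a' b' c' d' :
  mx2 a b c d = mx2 a' b' c' d' <-> [/\ a = a', b = b', c = c' & d = d'].
Proof.
split=> [/matrixP e | [-> -> -> ->] //].
by split; [have := e 0 0 | have := e 0 1 | have := e 1 0 | have := e 1 1]; rewrite !mxE /=.
Qed.

Lemma mx2M a b c d a' b' c' d' : mx2 a b c d * mx2 a' b' c' d' =
  mx2 (a * a' + b * c') (a * b' + b * d') (c * a' + d * c') (c * b' + d * d').
Proof.
apply/matrixP => i j; rewrite mxE !big_ord_recl big_ord0 !mxE /= addr0.
by case: (i == 0); case: (j == 0).
Qed.

Lemma mx2D a b c d a' b' c' d' :
  mx2 a b c d + mx2 a' b' c' d' = mx2 (a + a') (b + b') (c + c') (d + d').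
Proof. by apply/matrixP => i j; rewrite !mxE; case: (i == 0); case: (j == 0). Qed.

Lemma mx2N a b c d : - mx2 a b c d = mx2 (- a) (- b) (- c) (- d).
Proof. by apply/matrixP => i j; rewrite !mxE; case: (i == 0); case: (j == 0). Qed.

Lemma mx2Z k a b c d : k *: mx2 a b c d = mx2 (k * a) (k * b) (k * c) (k * d).
Proof. by apply/matrixP => i j; rewrite !mxE; case: (i == 0); case: (j == 0). Qed.

Lemma mx2_1 : 1 = mx2 1 0 0 1.
Proof.
by apply/matrixP => i j; rewrite !mxE (ord2E i) (ord2E j); case: (i == 0); case: (j == 0).
Qed.

Lemma mx2_0 : 0 = mx2 0 0 0 0.
Proof. by apply/matrixP => i j; rewrite !mxE; case: (i == 0); case: (j == 0). Qed.

Lemma det_mx2 a b c d : \det (mx2 a b c d) = a * d - b * c.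
Proof.
rewrite (expand_det_row _ 0) !big_ord_recl big_ord0 addr0 /cofactor !det_mx11.
by rewrite !mxE /= expr0 expr1 mul1r mulN1r mulrN.
Qed.

Lemma tr_mx2 a b c d : \tr (mx2 a b c d) = a + d.
Proof. by rewrite /mxtrace !big_ord_recl big_ord0 addr0 !mxE. Qed.

Definition mx2E := (mx2M, mx2D, mx2N, mx2Z, det_mx2, tr_mx2, mx2_inj).

Lemma mul0mx2 a b c d : (mx2 a b c d = 0) <-> [/\ a = 0, b = 0, c = 0 & d = 0].
Proof. by rewrite mx2_0 mx2_inj. Qed.

Lemma traceless_mx2P M : \tr M = 0 -> exists a b c, M = mx2 a b c (- a).
Proof.
have [a [b [c [d ->]]]] := mx2P M; rewrite tr_mx2 => /eqP.
by rewrite addrC addr_eq0 => /eqP ->; exists a, b, c.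
Qed.

Lemma trM_comm A B : \tr (A * B) = \tr (B * A).
Proof. exact: mxtrace_mulC. Qed.

End TwoByTwo.

(** * Traceless and nilpotent matrices in characteristic 3 *)

(** Reduces a = b to e = 0, where e combines known relations and [ring] or [field] identifies it
    with a - b. *)
Ltac lincomb e := apply/subr0_eq; transitivity e; [by (ring || field) | ].

Section CharThree.
Local Open Scope ring_scope.
Variable F : fieldType.
Hypothesis two : 2 = -1 :> F.
Implicit Types (A B M N P X J : 'M[F]_2) (a b c d k : F).

(** For invertible X and traceless nonzero M: X preserves the kernel of M if M is nilpotent, and
    normalizes the torus F + F M if M is invertible. *)
Definition semicommute X M := exists k, X * M = k *: (M * X).

Definition nilmx P := \tr P = 0 /\ \det P = 0.

Lemma two_neq0 : (2 : F) != 0.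
Proof. by rewrite two oppr_eq0 oner_eq0. Qed.

Lemma eq0_double a : a + a = 0 -> a = 0.
Proof.
move=> h; apply/eqP; have : 2 * a == 0 by rewrite mulr_natl mulr2n h.
by rewrite mulf_eq0 (negPf two_neq0).
Qed.

(** In the coordinates (x, y, z) of traceless matrices, commutation says that the cross product
    vanishes. *)
Lemma traceless_comm M N : \tr M = 0 -> \tr N = 0 -> M != 0 ->
  M * N = N * M -> exists k, N = k *: M.
Proof.
move=> /traceless_mx2P[x [y [z ->]]] /traceless_mx2P[a [b [c ->]]] /eqP.
rewrite !mx2E mul0mx2 => M0 [e1 e2 e3 _].
have h1 : y * c - b * z = 0 by lincomb ((x * a + y * c) - (a * x + b * z)); rewrite e1 subrr.
have h2 : x * b - y * a = 0.
  by apply: eq0_double; lincomb ((x * b + y * - a) - (a * y + b * - x)); rewrite e2 subrr.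
have h3 : z * a - x * c = 0.
  by apply: eq0_double; lincomb ((z * a + - x * c) - (c * x + - a * z)); rewrite e3 subrr.
case: (eqVneq x 0) => [x0|nx]; last first.
  exists (a / x); rewrite !mx2E; split; [by field | | | by field].
    by apply: (mulfI nx); lincomb (x * b - y * a); rewrite ?h2.
  by apply: (mulfI nx); lincomb (- (z * a - x * c)); rewrite ?h3 ?oppr0.
case: (eqVneq y 0) => [y0|ny]; last first.
  exists (b / y); rewrite !mx2E; split; [ | by field | | ].
  - by apply: (mulfI ny); lincomb (- (x * b - y * a)); rewrite h2 oppr0.
  - by apply: (mulfI ny); lincomb (y * c - b * z); rewrite h1.
  - by apply: (mulfI ny); lincomb (x * b - y * a); rewrite h2.
case: (eqVneq z 0) => [z0|nz]; first by case: M0; rewrite x0 y0 z0 oppr0.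
move: h1 h3; rewrite x0 y0 !mul0r sub0r subr0 => /eqP.
rewrite oppr_eq0 mulf_eq0 (negPf nz) orbF => /eqP -> /eqP.
rewrite mulf_eq0 (negPf nz) => /eqP ->; exists (c / z).
rewrite !mx2E !mulr0 oppr0 mulr0; split => //.
by field.
Qed.

(** The identity has trace 2 = -1, so adding (tr A) 1 cancels the trace of A. *)
Lemma tracelessD A : \tr (A + (\tr A)%:A) = 0.
Proof.
rewrite raddfD /= mxtraceZ mxtrace1 two; lincomb (0 : F) => //.
Qed.

Lemma commute_scalar_add A M : \tr M = 0 -> M != 0 -> A * M = M * A ->
  exists a k, A = a%:A + k *: M.
Proof.
move=> tM M0 AM; have [|k Ek] := traceless_comm tM (tracelessD A) M0.
  by rewrite mulrDr mulrDl AM -scalerAl -scalerAr mul1r mulr1.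
by exists (- \tr A), k; rewrite -Ek addrCA scaleNr addNr addr0.
Qed.

Lemma sqr_traceless M : \tr M = 0 -> M * M = (- \det M)%:A.
Proof.
move=> /traceless_mx2P[x [y [z ->]]]; rewrite mx2_1 !mx2E; split; ring.
Qed.

Lemma tr_alg a : \tr (a%:A : 'M[F]_2) = - a.
Proof. by rewrite mxtraceZ mxtrace1 two mulrN1. Qed.

Lemma det_add1 P : \tr P = 0 -> \det (1 + P) = 1 + \det P.
Proof.
move=> /traceless_mx2P[x [y [z ->]]]; rewrite mx2_1 !mx2E; ring.
Qed.

Lemma nilpZ k P : nilmx P -> nilmx (k *: P).
Proof. by case=> t d; split; rewrite ?mxtraceZ ?detZ ?t ?d mulr0. Qed.

(** Nilpotents are the isotropic vectors of the trace form on the three-dimensional space of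
    traceless matrices. The form has Witt index one, so orthogonal isotropic vectors are
    proportional. *)
Lemma tr_nilp_mul_eq0 P P' : nilmx P -> nilmx P' -> P != 0 -> \tr (P * P') = 0 ->
  exists k, P' = k *: P.
Proof.
case=> tP dP [tP' dP'] P0 h; apply: traceless_comm => //.
move: tP dP tP' dP' P0 h => /traceless_mx2P[x [y [z ->]]] + /traceless_mx2P[a [b [c ->]]].
rewrite !mx2E => d1 d2 _ h.
suff [h1 h2 h3] : [/\ x * b = y * a, z * a = x * c & y * c = z * b].
  by split; [lincomb (y * c - z * b) | lincomb ((x * b - y * a) *+ 2)
   | lincomb ((z * a - x * c) *+ 2) | lincomb (z * b - y * c)];
   rewrite ?h1 ?h2 ?h3 subrr ?mul0rn.
(* The squares below vanish modulo x^2 = -yz, a^2 = -bc, 2xa + yc + zb = 0. *)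
have sq (u : F) : u * u = 0 -> u = 0 by move=> /eqP; rewrite mulf_eq0 orbb => /eqP.
split; apply/subr0_eq/sq.
- lincomb (- (b ^+ 2 * (x * - x - y * z)) - y ^+ 2 * (a * - a - b * c)
           - y * b * (x * a + y * c + (z * b + - x * - a))).
  by rewrite d1 d2 h; ring.
- lincomb (- (c ^+ 2 * (x * - x - y * z)) - z ^+ 2 * (a * - a - b * c)
           - z * c * (x * a + y * c + (z * b + - x * - a))).
  by rewrite d1 d2 h; ring.
- lincomb ((y * c + z * b - 2 * x * a) * (x * a + y * c + (z * b + - x * - a)) 
    + 4 * (b * c * (x * - x - y * z) - x ^+ 2 * (a * - a - b * c))).
  by rewrite d1 d2 h; ring.
Qed.

(** A singular P factors as u v^T, and then P X P = (v^T X u) P. *)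
Lemma mul3_det0 P X : \det P = 0 -> P * X * P = \tr (P * X) *: P.
Proof.
have [a [b [c [d ->]]]] := mx2P X; have [x [y [z [t ->]]]] := mx2P P.
rewrite !mx2E => h; split.
- lincomb (- d * (x * t - y * z)); by rewrite h mulr0.
- lincomb (b * (x * t - y * z)) => //; by rewrite h mulr0.
- lincomb (c * (x * t - y * z)); by rewrite h mulr0.
- lincomb (- a * (x * t - y * z)); by rewrite h mulr0.
Qed.

(** Both sides say that X preserves the kernel of P. Left to right, (P X) ^ 2 = 0 kills the trace;
    right to left, P X P = 0 makes P and X P X^-1 orthogonal nilpotents, hence proportional. *)
Lemma nilp_semicommute X P : \det X = 1 -> nilmx P -> P != 0 ->
  semicommute X P <-> \tr (P * X) = 0.
Proof.
move=> dX nP P0; split.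
  case=> k Ek; have: (P * X) * (P * X) = 0.
    by rewrite -mulrA (mulrA X) Ek -scalerAl -scalerAr !mulrA sqr_traceless ?(proj1 nP) //
       (proj2 nP) oppr0 scale0r !mul0r scaler0.
  have [a [b [c [d ->]]]] := mx2P (P * X); rewrite !mx2E mul0mx2 => -[h1 h2 h3 h4].
  apply/eqP; case: (eqVneq (a + d) 0) => // nad.
  have b0 : b = 0 by apply: (mulfI nad); lincomb (a * b + b * d); rewrite ?h2.
  have c0 : c = 0 by apply: (mulfI nad); lincomb (c * a + d * c); rewrite ?h3.
  move: h1 h4 nad; rewrite b0 c0 !mul0r addr0 add0r => /eqP + /eqP.
  by rewrite !mulf_eq0 !orbb => /eqP -> /eqP ->; rewrite addr0 eqxx.
move=> h; have uX : X \is a GRing.unit by rewrite unitmxE dX unitr1.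
have PXP : P * X * P = 0 by rewrite mul3_det0 ?h ?scale0r // (proj2 nP).
have [||k Ek] := @tr_nilp_mul_eq0 P (X * P * X^-1) nP _ P0.
- split; first by rewrite trM_comm mulrA mulVr // mul1r (proj1 nP).
  by rewrite !det_mulmx (proj2 nP) mulr0 mul0r.
- by rewrite !mulrA PXP mul0r raddf0.
by exists k; rewrite -[X * P]mulr1 -(mulVr uX) mulrA Ek scalerAl.
Qed.

(** Multiplying by M, whose square is a nonzero scalar, and taking traces gives tr X = k tr X. *)
Lemma semicommute_commute X M : \tr M = 0 -> \det M != 0 -> \tr X != 0 ->
  semicommute X M -> X * M = M * X.
Proof.
move=> tM dM tX [k Ek]; suff k1 : k = 1 by rewrite Ek k1 scale1r.
have : \tr (X * M * M) = k * \tr (M * X * M) by rewrite Ek -scalerAl mxtraceZ.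
rewrite -(mulrA X) [\tr (M * X * M)]trM_comm (mulrA M M X) !sqr_traceless //.
rewrite -scalerAr -scalerAl mulr1 mul1r.
rewrite mxtraceZ => /eqP; rewrite -subr_eq0 -[X in X - _]mul1r -mulrBl !mulf_eq0 oppr_eq0.
by rewrite (negPf dM) (negPf tX) !orbF subr_eq0 eq_sym => /eqP.
Qed.

(** The nilpotents span the traceless matrices, on which the trace form is nondegenerate. *)
Lemma tr_nilp_test0 M : \tr M = 0 -> (forall P, nilmx P -> \tr (P * M) = 0) -> M = 0.
Proof.
move=> /traceless_mx2P[x [y [z ->]]] h.
have nP a b c : a * a + b * c = 0 -> nilmx (mx2 a b c (- a)).
  by move=> e; split; rewrite mx2E ?subrr // mulrN -opprD e oppr0.
have := h _ (nP 0 1 0 _); have := h _ (nP 0 0 1 _); have := h _ (nP 1 1 (-1) _).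
rewrite !mx2E => /(_ _)h1 /(_ _)h2 /(_ _)h3.
have z0 : z = 0 by rewrite -[RHS]h3; ring.
have y0 : y = 0 by rewrite -[RHS]h2; ring.
have : x + x = 0 by rewrite -[RHS]h1 ?z0 ?y0; ring.
by move/eq0_double => x0; rewrite mul0mx2 x0 y0 z0 oppr0.
Qed.

Lemma tr_mul_eq0 A : (forall X, \tr (X * A) = 0) -> A = 0.
Proof.
have [x [y [z [t ->]]]] := mx2P A => h; rewrite mul0mx2.
have := h (mx2 1 0 0 0); have := h (mx2 0 1 0 0); have := h (mx2 0 0 1 0); have := h (mx2 0 0 0 1).
by rewrite !mx2E !(mul0r, mul1r, addr0, add0r).
Qed.

(* The nilpotents (1 + M) X (1 - M) and (1 - M) X (1 + M) have their kernel and
   image spanned by the two eigenvectors of M. *)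
Lemma tr_nilp_split_comm M N : \tr M = 0 -> \det M = -1 ->
  (forall P, nilmx P -> \tr (P * M) = 0 -> \tr (P * N) = 0) -> M * N = N * M.
Proof.
move=> tM dM h; have M2 : M * M = 1 by rewrite sqr_traceless // dM opprK scale1r.
have MM e e' : (e, e') = (1, -1) \/ (e, e') = (-1, 1) ->
    (1 + e *: M) * (1 + e' *: M) = 0.
  case=> -[-> ->]; rewrite scale1r scaleN1r.
    by rewrite mulrDl mul1r mulrDr mulr1 mulrN M2 addrA subrK subrr.
  by rewrite mulrBl mul1r mulrDr mulr1 M2 [M + 1]addrC subrr.
have key e e' : (e, e') = (1, -1) \/ (e, e') = (-1, 1) ->
    (1 + e' *: M) * N * (1 + e *: M) = 0.
  move=> ee; apply: tr_mul_eq0 => X.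
  have e'e : (e', e) = (1, -1) \/ (e', e) = (-1, 1) by case: ee => -[-> ->]; [right|left].
  rewrite !mulrA trM_comm !mulrA; apply: h.
    split; first by rewrite -mulrA trM_comm -mulrA MM // mulr0 raddf0.
    have /(congr1 determinant) := MM _ _ ee; rewrite det0 !det_mulmx.
    by move=> d; rewrite mulrAC d mul0r.
  have -> : (1 + e *: M) * X * (1 + e' *: M) * M = e' *: ((1 + e *: M) * X * (1 + e' *: M)).
    rewrite -[LHS]mulrA scalerAr; congr (_ * _).
    by case: ee => -[_ ->]; rewrite mulrDl scalerDr -scalerAl M2 mul1r ?scale1r ?scaleN1r
       ?opprK addrC.
  by rewrite mxtraceZ -mulrA trM_comm -mulrA MM // mulr0 raddf0 mulr0.
have := key 1 (-1) (or_introl erefl); have := key (-1) 1 (or_intror erefl).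
rewrite !scale1r !scaleN1r !mulrDl !mulrDr !mul1r !mulr1 !mulNr !mulrN => h1 h2.
move: (M * N) (N * M) (M * N * M) h1 h2 => A B C h1 h2.
apply/subr0_eq/matrixP => i j.
move/matrixP/(_ i j): h1; move/matrixP/(_ i j): h2; rewrite !mxE => h1 h2.
by apply: eq0_double; rewrite -[RHS](subrr 0) -{1}h2 -h1; ring.
Qed.

End CharThree.

(** * Consequences of -1 not being a square *)

Section Aniso.
Local Open Scope ring_scope.
Variable F : fieldType.
Hypothesis two : 2 = -1 :> F.
Hypothesis nsq : forall a : F, a ^+ 2 != -1.
Implicit Types (A B M N P X J : 'M[F]_2) (a b c d k : F).

Lemma sum2sq_eq0 a b : a ^+ 2 + b ^+ 2 = 0 -> a = 0.
Proof.
case: (eqVneq b 0) => [-> /eqP|nb h]; first by rewrite expr0n addr0 sqrf_eq0 => /eqP.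
have /eqP[] := nsq (a / b); apply: (mulfI (expf_neq0 2 nb)).
by lincomb (a ^+ 2 + b ^+ 2); rewrite ?h.
Qed.

(** Otherwise J would preserve the kernel of P, with a square root of -1 as eigenvalue. In
    coordinates, the relations yield vanishing sums of two squares. *)
Lemma tr_nilp_aniso J P : \tr J = 0 -> \det J = 1 -> nilmx P -> \tr (P * J) = 0 -> P = 0.
Proof.
move=> tJ dJ [tP dP]; move: tJ tP dJ dP => /traceless_mx2P[a [b [c ->]]].
move=> /traceless_mx2P[x [y [z ->]]]; rewrite !mx2E => dJ dP h.
have y0 : y = 0.
  apply: (@sum2sq_eq0 _ (y * a - x * b)).
  lincomb (- y ^+ 2 * (a * - a - b * c - 1) - b ^+ 2 * (x * - x - y * z)
     - y * b * (x * a + y * c + (z * b + - x * - a))).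
  by rewrite dJ dP h; ring.
have z0 : z = 0.
  apply: (@sum2sq_eq0 _ (z * a - x * c)).
  lincomb (- z ^+ 2 * (a * - a - b * c - 1) - c ^+ 2 * (x * - x - y * z)
     - z * c * (x * a + y * c + (z * b + - x * - a))).
  by rewrite dJ dP h; ring.
have x0 : x = 0.
  by move: dP; rewrite y0 mul0r subr0 mulrN => /eqP; rewrite oppr_eq0 mulf_eq0 orbb => /eqP.
by rewrite mul0mx2 x0 y0 z0 oppr0.
Qed.

Lemma nilp_tr1 P : nilmx P -> P != 0 -> exists J, [/\ \tr J = 0, \det J = 1 & \tr (P * J) = 1].
Proof.
case=> /traceless_mx2P[x [y [z ->]]]; rewrite !mx2E => d /eqP; rewrite mul0mx2 => P0.
case: (eqVneq y 0) => [y0|ny]; last first.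
  (* With the upper row of -P and trace zero, det J = 1 forces the lower left entry, and then tr (P
     J) = 1 + det P. *)
  exists (mx2 (- x) (- y) ((1 + x ^+ 2) / y) x); rewrite !mx2E; split; first by ring.
    by field.
  lincomb ((x * - x - y * z)); by rewrite d.
case: (eqVneq x 0) => [x0|nx].
  case: (eqVneq z 0) => [z0|nz]; first by case: P0; rewrite x0 y0 z0 oppr0.
  exists (mx2 0 z^-1 (- z) 0); rewrite !mx2E x0 y0; split; [ring|by field|by field].
by move: d; rewrite y0 mul0r subr0 mulrN => /eqP; rewrite oppr_eq0 mulf_eq0 orbb (negPf nx).
Qed.

Lemma anticommute_tr0 A B : B \is a GRing.unit -> A * B = - (B * A) -> \tr A = 0.
Proof.
move=> uB AB; apply: (eq0_double two); apply/eqP; rewrite addr_eq0 -raddfN /=.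
by rewrite -[A in \tr A](mulrK uB) AB mulNr !raddfN /= trM_comm mulKr.
Qed.

(** X commutes with A, so X = a 1 + k A; commuting with B, which negates A, forces k = 0. *)
Lemma anticommute_central A B X : A * A = -1 -> B * B = -1 -> A * B = - (B * A) ->
  X * A = A * X -> X * B = B * X -> exists a, X = a%:A.
Proof.
move=> A2 B2 AB XA XB.
have A0 : A != 0.
  by apply/eqP => A0; move/eqP: A2; rewrite A0 mul0r eq_sym oppr_eq0 oner_eq0.
have uB : B \is a GRing.unit by apply/unitrP; exists (- B); rewrite mulNr mulrN B2 opprK.
have tA := anticommute_tr0 uB AB.
have [a [k Xak]] := commute_scalar_add two tA A0 XA; exists a.
suff k0 : k = 0 by rewrite Xak k0 scale0r addr0.
apply: (eq0_double two); apply/eqP.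
move: XB; rewrite Xak mulrDl mulrDr -!scalerAl -!scalerAr mul1r mulr1 AB scalerN.
move=> /addrI /eqP; rewrite -subr_eq0 -opprD oppr_eq0 -scalerDl scaler_eq0.
case/orP => [/eqP k0|/eqP BA0]; first by rewrite k0.
have : A * A * (B * B) == 0 by rewrite mulrA -(mulrA A) AB BA0 oppr0 mulr0 mul0r.
by rewrite A2 B2 mulrNN mulr1 oner_eq0.
Qed.

(* Conjugation averaged over the quaternion group generated by A and B is half
   the trace, by Schur's lemma. *)
Lemma quaternion_average A B X : A * A = -1 -> B * B = -1 -> A * B = - (B * A) ->
  X - A * X * A - B * X * B - A * B * X * (A * B) = (2 * \tr X)%:A.
Proof.
move=> A2 B2 AB; have BA : B * A = - (A * B) by rewrite AB opprK.
have A2l Y : A * (A * Y) = - Y by rewrite mulrA A2 mulN1r.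
have B2l Y : B * (B * Y) = - Y by rewrite mulrA B2 mulN1r.
have BAl Y : B * (A * Y) = - (A * (B * Y)) by rewrite mulrA BA mulNr -mulrA.
set L := LHS.
have [||a La] := @anticommute_central A B L A2 B2 AB.
- rewrite /L !mulrDl !mulrDr !(mulNr, mulrN) -!mulrA.
  rewrite !(A2, B2, BA, A2l, B2l, BAl, mulrN, mulr1, opprK).
  by rewrite [LHS]addrAC [X * A + _]addrC.
- rewrite /L !mulrDl !mulrDr !(mulNr, mulrN) -!mulrA.
  rewrite !(A2, B2, BA, A2l, B2l, BAl, mulrN, mulr1, opprK).
  by rewrite -[LHS]addrA [LHS]addrC addrA.
have tL : \tr L = 2 * a by rewrite La mxtraceZ mxtrace1 mulrC.
rewrite La; congr (_ *: _); apply: (mulfI (two_neq0 two)); rewrite -tL.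
rewrite /L !raddfB /= ![\tr (_ * X * _)]trM_comm.
rewrite -!mulrA !(A2, B2, BA, A2l, B2l, BAl, mulrN, mulr1, opprK).
by rewrite !raddfN /=; ring.
Qed.

End Aniso.

(** * Traces against a curve of nilpotent matrices *)

Section Poly.
Local Open Scope ring_scope.
Variable F : finFieldType.
Hypothesis two : 2 = -1 :> F.
Hypothesis q4 : (4 < #|F|)%N.
Implicit Types (A B M N P X J : 'M[F]_2) (a b c d k : F).

Lemma poly_eval0 (p : {poly F}) : (size p <= #|F|)%N -> (forall k, p.[k] = 0) -> p = 0.
Proof.
move=> sp h; apply: (@roots_geq_poly_eq0 _ p (enum F)) => //.
- by apply/allP => k _; rewrite rootE h.
- exact: enum_uniq.
- by rewrite -cardE.
Qed.

(** Along the nilpotents Q k, the traces against J - J' and J + J' are polynomials in k of degree at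
    most 2 whose product vanishes everywhere. As q > 4, the product is the zero polynomial, so one
    factor is. *)
Lemma nilp_tr_sqr J J' : \tr J = 0 -> \tr J' = 0 ->
  (forall P, nilmx P -> \tr (P * J) ^+ 2 = \tr (P * J') ^+ 2) -> J' = J \/ J' = - J.
Proof.
move=> tJ tJ' h.
pose f M : {poly F} := Poly [:: M 1 0; M 0 0 - M 1 1; - M 0 1].
pose Q k := mx2 k 1 (- k ^+ 2) (- k).
have fE M k : (f M).[k] = \tr (Q k * M).
  have [x [y [z [t ->]]]] := mx2P M; rewrite horner_Poly /= !mxE /= !mx2E; ring.
have nQ k : nilmx (Q k) by split; rewrite mx2E; ring.
have f0 M : \tr M = 0 -> f M = 0 -> M = 0.
  move=> /traceless_mx2P[x [y [z ->]]] fM.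
  have fi i : (f (mx2 x y z (- x)))`_i = 0 by rewrite fM coef0.
  have := fi 0; have := fi 1; have := fi 2; rewrite !coef_Poly /= !mxE /= opprK => /eqP.
  rewrite oppr_eq0 => /eqP -> /(eq0_double two) -> ->.
  by rewrite mul0mx2 oppr0.
have : f (J - J') * f (J + J') = 0.
  apply: poly_eval0 => [|k].
    apply: leq_trans (size_polyMleq _ _) _; apply: leq_trans q4.
    have sf M : (size (f M) <= 3)%N by apply: size_Poly.
    by rewrite -subn1 (leq_sub2r 1 (leq_add (sf _) (sf _))).
  rewrite hornerM !fE mulrBr mulrDr raddfB raddfD /=.
  by rewrite -subr_sqr h ?subrr.
move=> /eqP; rewrite mulf_eq0 => /orP[] /eqP/f0 e; [left|right].
  by apply/esym/subr0_eq; rewrite e // raddfB /= tJ tJ' subrr.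
by apply/eqP; rewrite -addr_eq0 addrC e // raddfD /= tJ tJ' addr0.
Qed.
End Poly.

(** * Solvable subgroups of GL(2,q) *)

Section GL2.
Local Open Scope ring_scope.
Variable F : finFieldType.
Hypothesis two : 2 = -1 :> F.
Hypothesis nsq : forall a : F, a ^+ 2 != -1.
Implicit Types (A B M N P X J : 'M[F]_2) (a b c d k t : F) (g h x y z : {'GL_2[F]}).

(* Locked because unfolding the group structure of {'GL_2[F]} makes unification slow. *)
Definition mat x : 'M[F]_2 := locked_with tt (GLval x).

Lemma matE x : mat x = GLval x. Proof. by rewrite /mat unlock. Qed.

Lemma matM x y : mat (x * y)%g = mat x * mat y. Proof. by rewrite !matE. Qed.

Lemma mat1 : mat 1%g = 1. Proof. by rewrite matE. Qed.

Lemma mat_inj : injective mat.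
Proof. by move=> x y; rewrite !matE => e; apply: val_inj. Qed.

Lemma mat_unit x : mat x \is a GRing.unit. Proof. by rewrite matE; apply: (valP x). Qed.

Lemma mem_SL2 x : (x \in SL2 F) = (\det (mat x) == 1).
Proof. by rewrite inE matE. Qed.

Definition of_mx M : {'GL_2[F]} := insubd (1%g : {'GL_2[F]}) M.

Lemma of_mxK M : \det M = 1 -> mat (of_mx M) = M.
Proof.
move=> d; have uM : M \in unitmx by rewrite unitmxE d unitr1.
by rewrite matE; apply: (insubdK (1%g : {'GL_2[F]}) uM).
Qed.

Lemma of_mx_SL2 M : \det M = 1 -> of_mx M \in SL2 F.
Proof. by move=> d; rewrite mem_SL2 of_mxK ?d. Qed.

Lemma matK x : of_mx (mat x) = x.
Proof. by rewrite matE; apply: val_inj; exact: (insubdK (1%g : {'GL_2[F]}) (valP x)). Qed.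

Definition line_stab M : {set {'GL_2[F]}} :=
  [set x | [exists k, mat x * M == k *: (M * mat x)]].

Lemma line_stabP x M : reflect (semicommute (mat x) M) (x \in line_stab M).
Proof.
by rewrite inE; apply: (iffP existsP) => -[k /eqP Ek]; exists k => //; apply/eqP.
Qed.

Lemma line_stab_group_set M : group_set (line_stab M).
Proof.
apply/group_setP; split; first by apply/line_stabP; exists 1; rewrite mat1 mul1r mulr1 scale1r.
move=> x y /line_stabP[k Ek] /line_stabP[l El]; apply/line_stabP; exists (l * k).
by rewrite matM -mulrA El -scalerAr mulrA Ek -scalerAl scalerA mulrA.
Qed.
Canonical line_stab_group M := Group (line_stab_group_set M).

Definition centm M : {set {'GL_2[F]}} := [set x | mat x * M == M * mat x].

Lemma centmP x M : reflect (mat x * M = M * mat x) (x \in centm M).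
Proof. by rewrite inE; apply: eqP. Qed.

Lemma centm_group_set M : group_set (centm M).
Proof.
apply/group_setP; split; first by apply/centmP; rewrite mat1 mul1r mulr1.
move=> x y /centmP ex /centmP ey; apply/centmP.
by rewrite matM -mulrA ey mulrA ex mulrA.
Qed.
Canonical centm_group M := Group (centm_group_set M).

Lemma centm_abelian M : \tr M = 0 -> M != 0 -> abelian (centm M).
Proof.
move=> tM M0; apply/centsP => x /centmP ex y /centmP ey; apply: mat_inj; rewrite !matM.
have [a [k ->]] := commute_scalar_add two tM M0 ex.
rewrite mulrDl mulrDr -!scalerAl -!scalerAr mul1r mulr1; congr (_ + _ *: _).
by [].
Qed.

(** The factor k is multiplicative in x, so commutators lie in [centm M], which is abelian. *)
Lemma line_stab_sol M : \tr M = 0 -> M != 0 -> solvable (line_stab M).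
Proof.
move=> tM M0; rewrite (series_sol (der_normal 1 _)) (abelian_sol (der_abelian 0 _)) andbT.
apply: solvableS (abelian_sol (centm_abelian tM M0)).
rewrite gen_subG; apply/subsetP => z /imset2P[x y /line_stabP[k Ek] /line_stabP[l El] ->].
have [e] : exists m, mat (x * y)%g * M = m *: (M * mat (x * y)%g)
    /\ mat (y * x)%g * M = m *: (M * mat (y * x)%g).
  exists (k * l); split.
    by rewrite matM -!mulrA El -scalerAr (mulrA (mat x)) Ek -scalerAl scalerA mulrC -mulrA.
  by rewrite matM -!mulrA Ek -scalerAr (mulrA (mat y)) El -scalerAl scalerA -mulrA.
have -> : (x * y)%g = (y * x * [~ x, y])%g by rewrite commgC.
rewrite matM => -[e1 e2].
apply/centmP; apply: (mulrI (mat_unit (y * x)%g)).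
by rewrite mulrA e1 [RHS]mulrA e2 -scalerAl; congr (_ *: _); apply: mulrA.
Qed.

Lemma semicommute_sol M g h : \tr M = 0 -> M != 0 ->
  semicommute (mat g) M -> semicommute (mat h) M -> solvable <<[set g; h]>>.
Proof.
move=> tM M0 /line_stabP gM /line_stabP hM; apply: solvableS (line_stab_sol tM M0).
by rewrite gen_subG subUset !sub1set gM.
Qed.
End GL2.
Arguments mat {F} x%_g : simpl never.

(** * Solvability criteria in finite groups *)

Section Groups.
Local Open Scope group_scope.

Lemma quotient_abelian_sol (gT : finGroupType) (G Z : {group gT}) :
  abelian Z -> G \subset 'N(Z) -> solvable (G / Z) = solvable G.
Proof.
move=> aZ nZ; apply/idP/idP => [sGZ|]; last exact: quotient_sol.
have nGZ : Z :&: G <| G by rewrite /normal subsetIr normsI ?normG.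
rewrite (series_sol nGZ) (isog_sol (second_isog nZ)) sGZ andbT.
exact: solvableS (subsetIl _ _) (abelian_sol aZ).
Qed.

Lemma quotient_gen2 (gT : finGroupType) (Z : {group gT}) x y :
  x \in 'N(Z) -> y \in 'N(Z) ->
  <<[set x; y]>> / Z = <<[set coset Z x; coset Z y]>>.
Proof.
move=> xN yN; rewrite quotient_gen; last by rewrite subUset !sub1set xN.
by rewrite /quotient morphimU !morphim_set1.
Qed.

(* The conjugates of x by powers of g generate an abelian normal subgroup. *)
Lemma cube_commute_sol (gT : finGroupType) (g x : gT) :
  g ^+ 3 = 1 -> commute x (x ^ g) -> solvable <<[set g; x]>>.
Proof.
move=> g3 c01; set y := x ^ g in c01; pose z := y ^ g.
have ggg : g * g * g = 1 by rewrite -g3 !expgS expg0 mulg1 mulgA.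
have zg : z ^ g = x by rewrite -!conjgM ?mulgA ggg conjg1.
have cJ a b : commute a b -> commute (a ^ g) (b ^ g) by move=> ab; rewrite /commute -!conjMg ab.
have c12 : commute y z by apply: cJ.
have c20 : commute z x by rewrite -zg; apply: cJ.
pose A := <<[set x; y; z]>>%G.
have aA : abelian A.
  rewrite abelian_gen; apply/centsP => a aA b bA; move: aA bA.
  rewrite !inE -!orbA => /or3P[] /eqP -> /or3P[] /eqP ->; rewrite /commute //; exact/esym.
have nA : <[g]> \subset 'N(A).
  rewrite cycle_subG -sub1set norms_gen // sub1set inE; apply/subsetP => a /imsetP[b].
  by rewrite !inE -!orbA => /or3P[] /eqP -> ->; rewrite ?zg eqxx ?orbT.
have sG : <<[set g; x]>> \subset A <*> <[g]>.
  rewrite gen_subG subUset !sub1set -[g \in _]cycle_subG joing_subr.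
  by rewrite (subsetP (joing_subl _ _)) // mem_gen // !inE eqxx.
apply: solvableS sG _; have nAg : A <| A <*> <[g]> by rewrite normalYl.
rewrite (series_sol nAg).
rewrite (abelian_sol aA) quotientYidl //=.
exact: quotient_sol (abelian_sol (cycle_abelian _)).
Qed.
End Groups.

(** * A unipotent element and an involution modulo scalars *)

Section Solvability.
Local Open Scope ring_scope.
Variable F : finFieldType.
Hypothesis two : 2 = -1 :> F.
Hypothesis nsq : forall a : F, a ^+ 2 != -1.
Implicit Types (A B M N P X J : 'M[F]_2) (a b c d k t : F) (g h x y z : {'GL_2[F]}).

Definition scalars : {set {'GL_2[F]}} := [set x | [exists a, mat x == a%:A]].

Lemma scalarsP x : reflect (exists a, mat x = a%:A) (x \in scalars).
Proof. by rewrite inE; apply: (iffP existsP) => -[k /eqP Ek]; exists k => //; apply/eqP. Qed.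

Lemma scalars_comm x y : x \in scalars -> (x * y = y * x)%g.
Proof.
case/scalarsP=> a Ea; apply: mat_inj.
by rewrite !matM Ea -scalerAl -scalerAr mul1r mulr1.
Qed.

Lemma scalars_group_set : group_set scalars.
Proof.
apply/group_setP; split; first by apply/scalarsP; exists 1; rewrite mat1 scale1r.
move=> x y /scalarsP[a Ea] /scalarsP[b Eb]; apply/scalarsP; exists (a * b).
by rewrite matM Ea Eb -scalerAl mul1r scalerA.
Qed.
Canonical scalars_group := Group scalars_group_set.

Lemma scalars_abelian : abelian scalars.
Proof. by apply/centsP => x xS y _; apply: scalars_comm. Qed.

Lemma norm_scalars x : x \in ('N(scalars))%g.
Proof.
apply: (subsetP (cent_sub _)); apply/centP => y yS; apply/esym.
exact: scalars_comm.
Qed.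

(** Polarizing A ^ 2 = - det A gives A B + B A = tr (A B) for traceless matrices. *)
Lemma anticommute_traceless A B : \tr A = 0 -> \tr B = 0 -> \tr (A * B) = 0 ->
  A * B = - (B * A).
Proof.
move=> /traceless_mx2P[x [y [z ->]]] /traceless_mx2P[a [b [c ->]]]; rewrite !mx2E => h.
by split; [lincomb (x * a + y * c + (z * b + - x * - a)) | ring | ring
  | lincomb (x * a + y * c + (z * b + - x * - a))].
Qed.

(** The trace of h h ^ g is 1 - tr (P J) ^ 2 = 0, so h and h ^ g anticommute. Modulo scalars they
    commute and g has order dividing 3, so [cube_commute_sol] applies. *)
Lemma unipotent_involution_sol P J g h : nilmx P -> mat g = 1 + P -> \tr J = 0 ->
  \det J = 1 -> mat h = J -> \tr (P * J) ^+ 2 = 1 -> solvable <<[set g; h]>>.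
Proof.
move=> [tP dP] Eg tJ dJ Eh t1.
have P2 : P * P = 0 by rewrite sqr_traceless // dP oppr0 scale0r.
have J2 : J * J = -1 by rewrite sqr_traceless // dJ scaleN1r.
have Egi : mat g^-1 = 1 - P.
  apply: (mulIr (mat_unit g)); rewrite -matM mulVg mat1 Eg.
  by rewrite mulrBl mul1r mulrDr mulr1 P2 addr0 addrK.
rewrite -(quotient_abelian_sol scalars_abelian); last by apply/subsetP => x _; apply: norm_scalars.
rewrite quotient_gen2 ?norm_scalars //; apply: cube_commute_sol.
  rewrite -morphX ?norm_scalars //= (_ : (g ^+ 3)%g = 1%g) ?morph1 //.
  apply: mat_inj; rewrite !expgS expg0 mulg1 !matM Eg.
  rewrite !mulrDl !mulrDr !mul1r !mulr1 P2 !(addr0, mulr0).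
  have P3 : P + P + P = 0.
    rewrite -[P]scale1r -!scalerDl (_ : 1 + 1 + 1 = 0) ?scale0r //.
    by rewrite -mulr2n two addNr.
  by rewrite mat1 -!addrA [X in _ + X]addrA P3 addr0.
rewrite -morphJ ?norm_scalars //.
have Eb : mat (h ^ g)%g = (1 - P) * (J * (1 + P)) by rewrite !matM Egi Eh Eg.
have acomm : mat h * mat (h ^ g)%g = - (mat (h ^ g)%g * mat h).
  rewrite Eh; apply: anticommute_traceless => //.
    by rewrite Eb mulrA trM_comm mulrA -Eg -Egi -matM mulgV mat1 mul1r.
  rewrite Eb mulrA mulrBr mulr1 mulrBl !mulrDr !mulr1 (mulrA J J) J2.
  have -> : J * P * (J * P) = J * (P * J * P) by rewrite !mulrA.
  rewrite (mul3_det0 _ dP) raddfB !raddfD /= -scalerAr mxtraceZ.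
  rewrite !(trM_comm J P) [\tr (J * P * J)]trM_comm mulrA J2.
  rewrite !mulN1r !raddfN /= tP mxtrace1 two -expr2 t1; ring.
rewrite /commute -!morphM ?norm_scalars //; apply/rcoset_kercosetP; rewrite ?norm_scalars //.
apply/rcosetP; exists (of_mx (-1)).
  apply/scalarsP; exists (-1); rewrite of_mxK ?scaleN1r //.
  by rewrite mx2_1 !mx2E; ring.
apply: mat_inj; rewrite [RHS]matM of_mxK ?mulN1r ?matM //.
by rewrite mx2_1 !mx2E; ring.
Qed.
End Solvability.

(** * The prime field *)

Section PrimeField.
Local Open Scope ring_scope.
Variable F : finFieldType.
Hypothesis two : 2 = -1 :> F.
Hypothesis nsq : forall a : F, a ^+ 2 != -1.
Implicit Types (a b c d k t : F).

(** The field of three elements inside F, as the fixed points of the Frobenius map. *)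
Definition inF3 a := a ^+ 3 = a.

Lemma inF3D a b : inF3 a -> inF3 b -> inF3 (a + b).
Proof.
rewrite /inF3 => ea eb.
lincomb ((a ^+ 3 - a) + (b ^+ 3 - b) + (2 + 1) * (a ^+ 2 * b + a * b ^+ 2)).
by rewrite ea eb two !subrr addNr mul0r !addr0.
Qed.

Lemma inF3N a : inF3 a -> inF3 (- a).
Proof. by rewrite /inF3 => ea; rewrite exprNn ea -signr_odd expr1 mulN1r. Qed.

Lemma inF3_1 : inF3 1. Proof. exact: expr1n. Qed.

Lemma inF3_0 : inF3 0. Proof. by rewrite /inF3 expr0n. Qed.

Lemma inF3P a : inF3 a <-> [\/ a = 0, a = 1 | a = -1].
Proof.
split=> [|[] ->]; [|exact: inF3_0|exact: inF3_1|exact: inF3N inF3_1].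
move=> ea; have : a * ((a - 1) * (a + 1)) = 0 by lincomb (a ^+ 3 - a); rewrite ea subrr.
move=> /eqP; rewrite !mulf_eq0 subr_eq0 addr_eq0 => /or3P[] /eqP ->.
- exact: Or31. - exact: Or32. - exact: Or33.
Qed.

Lemma inF3_sqr a : inF3 (a ^+ 2) -> inF3 a.
Proof.
move=> /inF3P[/eqP|/eqP|/eqP e]; last by have := nsq a; rewrite e.
  by rewrite sqrf_eq0 => /eqP ->; apply: inF3_0.
by rewrite sqrf_eq1 => /orP[] /eqP ->; [apply: inF3_1 | apply/inF3N/inF3_1].
Qed.
End PrimeField.

(** * Solvable groups of matrices of determinant one *)

Section Structure.
Local Open Scope ring_scope.
Variable F : finFieldType.
Hypothesis two : 2 = -1 :> F.
Hypothesis nsq : forall a : F, a ^+ 2 != -1.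
Variables (gT : finGroupType) (rho : gT -> 'M[F]_2).
Hypothesis rhoM : forall x y, rho (x * y)%g = rho x * rho y.
Hypothesis rho1 : rho 1%g = 1.
Implicit Types (A B M N P X J : 'M[F]_2) (a b c d k t : F) (g h x y z : gT).

Lemma rho_unit x : rho x \is a GRing.unit.
Proof. by apply/unitrP; exists (rho x^-1%g); rewrite -!rhoM mulVg mulgV rho1. Qed.

(** By Cayley-Hamilton, the inverse of X is (tr X) 1 - X when det X = 1. *)
Lemma tr_inv x : \det (rho x) = 1 -> \tr (rho x^-1%g) = \tr (rho x).
Proof.
move=> dx; have -> : rho x^-1%g = (\tr (rho x))%:A - rho x.
  apply: (mulrI (rho_unit x)); rewrite -rhoM mulgV rho1 mx2_1.
  have [a [b [c [d E]]]] := mx2P (rho x); rewrite E in dx *.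
  move: dx; rewrite !mx2E => dx.
  by split; [lincomb (- (a * d - b * c - 1)) | ring | ring | lincomb (- (a * d - b * c - 1))];
    rewrite dx subrr oppr0.
rewrite raddfB /= tr_alg //; lincomb (- (2 + 1) * \tr (rho x)).
by rewrite two addNr oppr0 mul0r.
Qed.

Let scalar : {set gT} := [set x | [exists a, rho x == a%:A]].

Let scalarP x : reflect (exists a, rho x = a%:A) (x \in scalar).
Proof.
by rewrite inE; apply: (iffP existsP) => -[k /eqP Ek]; exists k => //; apply/eqP.
Qed.

Lemma nonscalar_derived (H : {group gT}) : solvable H -> H \subset scalar \/
  exists n, ~~ (H^`(n) \subset scalar)%g /\ (H^`(n.+1) \subset scalar)%g.
Proof.
move=> /derivedP[n Hn]; have : (H^`(n) \subset scalar)%g.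
  rewrite Hn; apply/subsetP => x /set1P ->; apply/scalarP.
  by exists 1; rewrite rho1 scale1r.
elim: n {Hn} => [|n IH]; first by left.
by case: (boolP (H^`(n) \subset scalar)%g) => [/IH // | nH sH]; right; exists n.
Qed.

Lemma commute_or_anticommute x y : \det (rho x) = 1 -> \det (rho y) = 1 ->
  [~ x, y]%g \in scalar ->
  rho x * rho y = rho y * rho x \/ rho x * rho y = - (rho y * rho x).
Proof.
move=> dx dy /scalarP[a Ea].
have Exy : rho x * rho y = a *: (rho y * rho x).
  by rewrite -[LHS]rhoM commgC 2!rhoM Ea -scalerAr mulr1.
have : a ^+ 2 == 1.
  apply/eqP; have /(congr1 determinant) := Exy.
  by rewrite detZ !det_mulmx dx dy !mulr1.
rewrite sqrf_eq1 Exy => /orP[] /eqP ->; [left|right]; by rewrite ?scale1r ?scaleN1r.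
Qed.

(** If the image of A is commutative, the traceless part M of a nonscalar element commutes with its
    H-conjugates, which are thus multiples of M. Otherwise an anticommuting pair in A allows
    averaging over a quaternion group. *)
Lemma quaternion_dichotomy (H A : {group gT}) :
  (forall x, x \in H -> \det (rho x) = 1) -> A \subset H ->
  (H \subset 'N(A))%g -> ~~ (A \subset scalar) ->
  (forall x y, x \in A -> y \in A -> [~ x, y]%g \in scalar) ->
  (exists M, [/\ \tr M = 0, M != 0 & forall x, x \in H -> semicommute (rho x) M])
  \/ (forall x, x \in H -> inF3 (\tr (rho x))).
Proof.
move=> dH sAH nAH nZ Zn.
have dA x : x \in A -> \det (rho x) = 1 by move/(subsetP sAH)/dH.
have [a aA naZ] := subsetPn nZ.
have caA x y : x \in A -> y \in A ->
    rho x * rho y = rho y * rho x \/ rho x * rho y = - (rho y * rho x).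
  by move=> xA yA; apply: commute_or_anticommute (dA x xA) (dA y yA) (Zn x y xA yA).
have JA x y : x \in A -> y \in H -> (x ^ y)%g \in A.
  by move=> xA yH; rewrite memJ_norm // (subsetP nAH).
case: (boolP [forall x in A, forall y in A, rho x * rho y == rho y * rho x]) => cA.
  left; pose M := rho a + (\tr (rho a))%:A; exists M.
  have tM : \tr M = 0 by apply: tracelessD.
  have M0 : M != 0.
    apply: contra naZ; rewrite addr_eq0 => /eqP Ea; apply/scalarP.
    by exists (- \tr (rho a)); rewrite scaleNr.
  split=> // x xH.
  have Mx : rho x * M = (rho (a ^ x^-1)%g + (\tr (rho a))%:A) * rho x.
    rewrite mulrDr mulrDl -scalerAl -scalerAr mul1r mulr1; congr (_ + _).
    by rewrite -!rhoM conjgE invgK !mulgA mulgKV.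
  have cM : M * rho (a ^ x^-1)%g = rho (a ^ x^-1)%g * M.
    rewrite mulrDr mulrDl -scalerAl -scalerAr mul1r mulr1; congr (_ + _).
    have := cA; move/forall_inP/(_ a aA)/forall_inP/(_ (a ^ x^-1)%g).
    by rewrite JA ?groupV // => /(_ isT)/eqP.
  have [||k Ek] := @traceless_comm _ two M (rho (a ^ x^-1)%g + (\tr (rho a))%:A) tM _ M0.
  - rewrite mxtraceD tr_alg // conjgE invgK !rhoM mulrA trM_comm mulrA -rhoM mulVg rho1 mul1r.
    by rewrite subrr.
  - by rewrite [LHS]mulrDr [RHS]mulrDl cM -scalerAl -scalerAr mul1r mulr1.
  by exists k; rewrite Mx Ek -scalerAl.
right=> h hH.
have {cA}[b bA [c cA anti]] :
    exists2 b, b \in A & exists2 c, c \in A & rho b * rho c = - (rho c * rho b).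
  move: cA; rewrite negb_forall_in => /exists_inP[b bA].
  rewrite negb_forall_in => /exists_inP[c cA nbc].
  exists b => //; exists c => //; case: (caA b c bA cA) => // e.
  by rewrite e eqxx in nbc.
have antiC : rho c * rho b = - (rho b * rho c) by rewrite anti opprK.
have sq1 x : x \in A -> \tr (rho x) = 0 -> rho x * rho x = -1.
  move=> xA tx; rewrite sqr_traceless // dH ?scaleN1r //; exact: (subsetP sAH).
have tr0 x y : rho x * rho y = - (rho y * rho x) -> \tr (rho x) = 0.
  exact: anticommute_tr0 (rho_unit y).
have b2 := sq1 b bA (tr0 b c anti); have c2 := sq1 c cA (tr0 c b antiC).
(* An element of A that anticommutes with b or c has trace 0; one that commutes with both is a
   scalar of square 1. *)
have inF3A x : x \in A -> inF3 (\tr (rho x)).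
  move=> xA; case: (caA x b xA bA) => [xb|/tr0->]; last exact: inF3_0.
  case: (caA x c xA cA) => [xc|/tr0->]; last exact: inF3_0.
  have [k Ek] := anticommute_central two b2 c2 anti xb xc.
  rewrite Ek tr_alg //; apply/inF3N/(inF3_sqr nsq).
  have := dH x (subsetP sAH x xA); rewrite Ek mx2_1 !mx2E !mulr0 subr0 !mulr1 -expr2 => ->.
  exact: inF3_1.
(* Multiplied by [rho h], the average of [rho h^-1] has as trace a signed sum of the traces of 1 and
   of h x h^-1 x, for x = b, c, b c, all in A. The other side gives 2 tr (rho h) ^ 2. *)
have := quaternion_average two (rho h^-1%g) b2 c2 anti.
move/(congr1 (fun X => \tr (rho h * X))).
rewrite -scalerAr mulr1 mxtraceZ tr_inv ?dH //.
have term x : x \in A -> inF3 (\tr (rho h * (rho x * rho h^-1%g * rho x))).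
  move=> xA; rewrite -!rhoM; apply: inF3A; rewrite !mulgA; apply: groupM => //.
  by have := JA x h^-1%g xA; rewrite groupV conjgE invgK mulgA; apply.
have := term (b * c)%g (groupM bA cA); rewrite (rhoM b c).
have := term c cA; have := term b bA.
rewrite !mulrBr !raddfB /= -(rhoM h h^-1%g) mulgV rho1 mxtrace1 two => s1 s2 s3 e.
apply: (inF3_sqr nsq); have -> : \tr (rho h) ^+ 2 = - (2 * \tr (rho h) * \tr (rho h)).
  by rewrite two; ring.
rewrite two -e; apply: inF3N. do 3 (apply: (inF3D two); last exact: inF3N).
exact/inF3N/inF3_1.
Qed.

Lemma solvable_dichotomy (H : {group gT}) :
  (forall x, x \in H -> \det (rho x) = 1) -> solvable H ->
  (exists M, [/\ \tr M = 0, M != 0 & forall x, x \in H -> semicommute (rho x) M])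
  \/ (forall x, x \in H -> inF3 (\tr (rho x))).
Proof.
move=> dH solH; case: (nonscalar_derived solH) => [sHZ | [n [nZ Zn]]].
  (* Scalars commute with everything: any nonzero traceless matrix would do. *)
  left; exists (mx2 0 1 0 0); rewrite mx2E addr0; split=> //.
    by apply/eqP => /mul0mx2[_ /eqP]; rewrite oner_eq0.
  move=> x /(subsetP sHZ)/scalarP[a ->]; exists 1.
  by rewrite -scalerAl -scalerAr mul1r mulr1 scale1r.
apply: (quaternion_dichotomy dH (der_sub n H) (der_norm n H) nZ) => x y xA yA.
exact: (subsetP Zn) (mem_commg xA yA).
Qed.
End Structure.

(** * Solvabilizers in SL(2,q) *)

Lemma solvabilizerV (gT : finGroupType) (G : {set gT}) (x : gT) :
  solvabilizer G x^-1%g = solvabilizer G x.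
Proof.
apply/setP => y; rewrite !inE; congr (_ && solvable _).
have sub z : (<<[set z; y]>> \subset <<[set z^-1; y]>>)%g.
  by rewrite gen_subG subUset !sub1set -[z \in _]groupV !mem_gen ?inE ?eqxx ?orbT.
by apply/eqP; rewrite eqEsubset sub andbT; have := sub x^-1%g; rewrite invgK.
Qed.

Section Solvabilizers.
Local Open Scope ring_scope.
Variable F : finFieldType.
Hypothesis two : 2 = -1 :> F.
Hypothesis nsq : forall a : F, a ^+ 2 != -1.
Hypothesis q4 : (4 < #|F|)%N.
Implicit Types (A B M N P X J : 'M[F]_2) (a b c d k t : F) (g h x y z : {'GL_2[F]}).

Local Notation Sol := (solvabilizer (SL2 F)).

Lemma exists_not_inF3 : exists t, ~ inF3 t.
Proof.
case: (boolP [exists t : F, t ^+ 3 != t]) => [/existsP[t /eqP nt]|]; first by exists t.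
rewrite negb_exists => /forallP sF; move: q4; rewrite -cardsT ltnNge.
suff -> : (#|[set: F]| <= 4)%N by [].
apply: (@leq_trans #|[set 0; 1; -1 : F]|); last first.
  by rewrite setUC !cardsU1 cards1; do 2 case: (_ \notin _).
apply/subset_leq_card/subsetP => t _; have := sF t; rewrite negbK => /eqP/(inF3P t).
by rewrite !inE -orbA; case=> ->; rewrite eqxx ?orbT.
Qed.

Lemma inF3_multiples t : (forall k, inF3 (k * t)) -> t = 0.
Proof.
move=> h; apply/eqP; case: (eqVneq t 0) => // nt; have [k []] := exists_not_inF3.
by rewrite -(divfK nt k); apply: h.
Qed.

Lemma mem_solP g h : g \in SL2 F -> h \in Sol g ->
  (exists M, [/\ \tr M = 0, M != 0, semicommute (mat g) M & semicommute (mat h) M])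
  \/ [/\ inF3 (\tr (mat g)), inF3 (\tr (mat h)) & inF3 (\tr (mat g * mat h))].
Proof.
move=> gS; rewrite inE => /andP[hS sol].
have sS : (<<[set g; h]>> \subset SL2 F)%g.
  by rewrite gen_subG; apply/subsetP => x /set2P[] ->.
have gH : g \in <<[set g; h]>>%g by rewrite mem_gen // !inE eqxx.
have hH : h \in <<[set g; h]>>%g by rewrite mem_gen // !inE eqxx orbT.
have dS x : x \in <<[set g; h]>>%g -> \det (mat x) = 1.
  by move/(subsetP sS); rewrite mem_SL2 => /eqP.
have [[M [tM M0 sc]]|sm] := solvable_dichotomy two nsq (@matM F) (mat1 F) dS sol.
  by left; exists M; split => //; apply: sc.
by right; split; rewrite -?matM; apply: sm; rewrite ?groupM.
Qed.

Lemma mem_sol_semicommute M g h : h \in SL2 F -> \tr M = 0 -> M != 0 ->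
  semicommute (mat g) M -> semicommute (mat h) M -> h \in Sol g.
Proof. by move=> hS tM M0 gM hM; rewrite inE hS; apply: (semicommute_sol two tM M0). Qed.

Lemma sol_sym g h : g \in SL2 F -> h \in Sol g -> g \in Sol h.
Proof. by move=> gS; rewrite !inE setUC => /andP[_ ->]; rewrite -mem_SL2 gS. Qed.

Lemma sol_coset g h : coset (scalars F) g = coset (scalars F) h -> Sol g = Sol h.
Proof.
move=> e; apply/setP => x; rewrite !inE; congr (_ && _).
have nS (H : {group {'GL_2[F]}}) : (H \subset 'N(scalars F))%g.
  by apply/subsetP => y _; apply: norm_scalars.
rewrite -!(quotient_abelian_sol (scalars_abelian F)) ?nS //.
by rewrite !quotient_gen2 ?norm_scalars //= e.
Qed.

Lemma sol_scalar g : g \in scalars F -> Sol g = SL2 F.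
Proof.
move=> gZ; apply/setP => x; rewrite inE andb_idr // => _; apply: abelian_sol.
rewrite abelian_gen; apply/centsP => a + b.
by rewrite !inE => /orP[] /eqP -> /orP[] /eqP ->; rewrite /commute ?(scalars_comm _ gZ).
Qed.

Lemma mem_sol_id g : g \in SL2 F -> g \in Sol g.
Proof.
move=> gS; rewrite inE gS setUid; apply: abelian_sol; rewrite abelian_gen.
by apply/centsP => a /set1P -> b /set1P ->.
Qed.

Definition unip P : {'GL_2[F]} := of_mx (1 + P).

Lemma det_unip P : nilmx P -> \det (1 + P) = 1.
Proof. by case=> tP dP; rewrite det_add1 // dP addr0. Qed.

Lemma mat_unip P : nilmx P -> mat (unip P) = 1 + P.
Proof. by move=> nP; rewrite of_mxK // det_unip. Qed.

Lemma unip_SL2 P : nilmx P -> unip P \in SL2 F.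
Proof. by move=> nP; rewrite of_mx_SL2 // det_unip. Qed.

Lemma unip0 : unip 0 = 1%g.
Proof. by rewrite /unip addr0 -mat1 matK. Qed.

Lemma tr_nilp_sqr P : nilmx P -> \tr (P * P) = 0.
Proof. by case=> tP dP; rewrite sqr_traceless // dP oppr0 scale0r mxtrace0. Qed.

(** A nontrivial unipotent element fixes one line only and normalizes no torus: its trace -1 is
    nonzero, so if det M were nonzero it would commute with M, making M a multiple of the singular
    P. *)
Lemma unip_semicommute P M : nilmx P -> P != 0 -> \tr M = 0 -> M != 0 ->
  semicommute (1 + P) M -> nilmx M /\ exists k, M = k *: P.
Proof.
move=> nP P0 tM M0 sc; case: (eqVneq (\det M) 0) => [dM|dM].
  have nM : nilmx M by [].
  split=> //; apply: tr_nilp_mul_eq0 => //.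
  have := (nilp_semicommute two (det_unip nP) nM M0).1 sc.
  by rewrite mulrDr mulr1 mxtraceD tM add0r trM_comm.
have tU : \tr (1 + P) != 0.
  by rewrite mxtraceD (proj1 nP) addr0 mxtrace1 two oppr_eq0 oner_eq0.
have := semicommute_commute tM dM tU sc.
rewrite mulrDl mulrDr mul1r mulr1 => /addrI PM.
have [k Ek] := traceless_comm two (proj1 nP) tM P0 PM.
by move: dM; rewrite Ek detZ (proj2 nP) mulr0 eqxx.
Qed.

(** In the first case of [mem_solP], P and P' are both proportional to M, so tr (P P') = 0; in the
    second, (1 + P) (1 + P') has trace tr (P P') - 1. *)
Lemma unip_sol_unip P P' : nilmx P -> nilmx P' -> unip P' \in Sol (unip P) ->
  inF3 (\tr (P * P')).
Proof.
move=> nP nP'; case: (eqVneq P 0) => [->|P0]; first by rewrite mul0r mxtrace0; have := @inF3_0 F.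
case: (eqVneq P' 0) => [->|P'0]; first by rewrite mulr0 mxtrace0; have := @inF3_0 F.
move/(mem_solP (unip_SL2 nP)); rewrite !mat_unip // => -[[M [tM M0 s1 s2]]|[_ _]].
  have [_ [k Ek]] := unip_semicommute nP P0 tM M0 s1.
  have [_ [l El]] := unip_semicommute nP' P'0 tM M0 s2.
  have k0 : k != 0 by apply: contra_neq M0 => k0; rewrite Ek k0 scale0r.
  have -> : P = (k^-1 * l) *: P' by rewrite -scalerA -El Ek scalerA mulVf // scale1r.
  by rewrite -scalerAl mxtraceZ tr_nilp_sqr // mulr0; apply: inF3_0.
rewrite mulrDl mul1r mulrDr mulr1 !mxtraceD mxtrace1 (proj1 nP) (proj1 nP') addr0 add0r two.
move=> h; rewrite -[X in inF3 X](addKr (-1)) opprK addrC.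
by apply: inF3D => //; apply: inF3_1.
Qed.

(** A common semicommuting M would be proportional to P, against [tr_nilp_aniso]; hence tr (P J) is
    a nonzero element of the prime field. The converse is [unipotent_involution_sol]. *)
Lemma unip_sol_involution P J : nilmx P -> P != 0 -> \tr J = 0 -> \det J = 1 ->
  unip P \in Sol (of_mx J) <-> \tr (P * J) ^+ 2 = 1.
Proof.
move=> nP P0 tJ dJ.
have tn0 : \tr (P * J) != 0.
  by apply: contra_neq P0 => /(tr_nilp_aniso nsq tJ dJ nP).
split=> [|t1]; last first.
  apply: sol_sym; first exact: unip_SL2.
  rewrite inE of_mx_SL2 //; apply: (unipotent_involution_sol two nP (mat_unip nP) tJ dJ _ t1).
  by rewrite of_mxK.
move/(mem_solP (of_mx_SL2 dJ)); rewrite mat_unip // of_mxK //.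
case=> [[M [tM M0 s1 s2]]|[_ _]].
  have [nM [k Ek]] := unip_semicommute nP P0 tM M0 s2.
  have := (nilp_semicommute two dJ nM M0).1 s1.
  rewrite Ek -scalerAl mxtraceZ => /eqP; rewrite mulf_eq0 (negPf tn0) orbF => /eqP k0.
  by rewrite Ek k0 scale0r eqxx in M0.
rewrite mulrDr mulr1 mxtraceD tJ add0r trM_comm => /inF3P[] e.
- by rewrite e eqxx in tn0.
- by rewrite e expr1n.
- by rewrite e sqrrN expr1n.
Qed.
End Solvabilizers.

(** * Torus solvabilizers and labels *)

Section Keys.
Local Open Scope ring_scope.
Variable F : finFieldType.
Hypothesis two : 2 = -1 :> F.
Hypothesis nsq : forall a : F, a ^+ 2 != -1.
Hypothesis q4 : (4 < #|F|)%N.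
Implicit Types (A B M N P X J : 'M[F]_2) (a b c d k t : F) (g h x y z : {'GL_2[F]}).

Local Notation Sol := (solvabilizer (SL2 F)).

(* The common solvabilizer of the elements of the torus F + F M of neither trace 0
   nor trace 1 or -1: the normalizer of the torus together with the stabilizers of
   the eigenvectors of M in F^2. *)
Definition torus_sol M : {set {'GL_2[F]}} :=
  [set h in SL2 F | (h \in line_stab M) ||
     [exists P : 'M[F]_2, [&& \tr P == 0, \det P == 0, P != 0, \tr (P * M) == 0
                    & \tr (P * mat h) == 0]]].

Lemma torus_solP M h : reflect
  (h \in SL2 F /\ (semicommute (mat h) M \/
     exists P, [/\ nilmx P, P != 0, \tr (P * M) = 0 & \tr (P * mat h) = 0]))
  (h \in torus_sol M).
Proof.
rewrite [h \in torus_sol M]inE; apply: (iffP andP) => -[hS H]; split=> //.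
  case/orP: H => [/line_stabP|]; first by left.
  by case/existsP=> P /and5P[/eqP tP /eqP dP P0 /eqP e1 /eqP e2]; right; exists P.
apply/orP; case: H => [/line_stabP|[P [[tP dP] P0 e1 e2]]]; [by left|right].
by apply/existsP; exists P; rewrite tP dP P0 e1 e2 !eqxx.
Qed.

Lemma det_torus M a b : \tr M = 0 -> \det (a%:A + b *: M) = a ^+ 2 + b ^+ 2 * \det M.
Proof. move=> /traceless_mx2P[x [y [z ->]]]; rewrite mx2_1 !mx2E; ring. Qed.

(** If tr g = -a were in the prime field, a ^ 2 = 1 would give b ^ 2 det M = 0. So g and h
    semicommute with a common N: either N is nilpotent, which is a shared eigenline, or N commutes
    with g as tr g is nonzero, and is proportional to M. *)
Lemma sol_torus M a b g : \tr M = 0 -> \det M != 0 -> a != 0 -> b != 0 ->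
  \det (mat g) = 1 -> mat g = a%:A + b *: M -> Sol g = torus_sol M.
Proof.
move=> tM dM a0 b0 dg Eg; have gS : g \in SL2 F by rewrite mem_SL2 dg.
have M0 : M != 0 by apply: contra_neq dM => ->; rewrite det0.
have tg : \tr (mat g) = - a by rewrite Eg mxtraceD tr_alg // mxtraceZ tM mulr0 addr0.
have tg0 : \tr (mat g) != 0 by rewrite tg oppr_eq0.
have gM : mat g * M = M * mat g.
  by rewrite Eg mulrDl mulrDr -!scalerAl -!scalerAr mul1r mulr1.
have trg P : \tr P = 0 -> \tr (P * mat g) = b * \tr (P * M).
  by move=> tP; rewrite Eg mulrDr mxtraceD -!scalerAr mulr1 !mxtraceZ tP mulr0 add0r.
apply/setP => h; apply/idP/torus_solP => [hs|[hS]].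
  have hS : h \in SL2 F by move: hs; rewrite inE => /andP[].
  split=> //; case: (mem_solP two nsq gS hs) => [[N [tN N0 s1 s2]]|[/inF3P sg _ _]]; last first.
    have a1 : a ^+ 2 = 1.
      by move: sg; rewrite tg => -[/eqP|/(congr1 (fun t => t ^+ 2))|/(congr1 (fun t => t ^+ 2))];
        rewrite ?oppr_eq0 ?(negPf a0) // !sqrrN expr1n.
    move: dg; rewrite Eg det_torus // a1 => /eqP; rewrite addrC -subr_eq0 addrK mulf_eq0.
    by rewrite sqrf_eq0 (negPf b0) (negPf dM).
  case: (eqVneq (\det N) 0) => [dN|dN]; [right|left].
    have nN : nilmx N by [].
    exists N; have := (nilp_semicommute two dg nN N0).1 s1; rewrite trg // => /eqP.
    rewrite mulf_eq0 (negPf b0) => /eqP e; split => //.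
    by apply/(nilp_semicommute two _ nN N0) => //; move: hS; rewrite mem_SL2 => /eqP.
  have gN := semicommute_commute tN dN tg0 s1.
  have NM : N * M = M * N.
    apply: (scalerI b0); rewrite scalerAr scalerAl; apply: (addrI (a *: N)).
    by move: gN; rewrite Eg mulrDl mulrDr -[in a%:A * _]scalerAl -[in _ * a%:A]scalerAr mul1r mulr1.
  have [k Ek] := traceless_comm two tN tM N0 NM.
  by case: s2 => l El; exists l; rewrite Ek -!scalerAr -scalerAl El !scalerA mulrC.
case=> [hM|[P [nP P0 PM Ph]]].
  by apply: (mem_sol_semicommute two hS tM M0 _ hM); exists 1; rewrite scale1r.
have [tP dP] := nP.
apply: (mem_sol_semicommute two hS tP P0); apply/(nilp_semicommute two _ nP P0) => //.
  by rewrite trg // PM mulr0.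
by move: hS; rewrite mem_SL2 => /eqP.
Qed.

(** For nonzero P, 1 + P normalizes no torus, so it must share an eigenline with M, which can only
    be that of P. *)
Lemma unip_torus P M : nilmx P -> \tr M = 0 -> \det M != 0 ->
  unip P \in torus_sol M <-> \tr (P * M) = 0.
Proof.
move=> nP tM dM; have M0 : M != 0 by apply: contra_neq dM => ->; rewrite det0.
case: (eqVneq P 0) => [->|P0].
  rewrite mul0r mxtrace0 unip0; split=> // _; apply/torus_solP; rewrite group1; split=> //.
  by left; exists 1; rewrite mat1 mul1r mulr1 scale1r.
split=> [/torus_solP[_]|PM].
  rewrite mat_unip //; case=> [s|[P' [nP' P'0 P'M]]].
    by have [[_ d] _] := unip_semicommute two nP P0 tM M0 s; rewrite d eqxx in dM.
  rewrite mulrDr mulr1 mxtraceD (proj1 nP') add0r => P'P.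
  have [k ->] := tr_nilp_mul_eq0 two nP' nP P'0 P'P.
  by rewrite -scalerAl mxtraceZ P'M mulr0.
apply/torus_solP; split; first exact: unip_SL2.
right; exists P; split=> //.
by rewrite mat_unip // mulrDr mulr1 mxtraceD (proj1 nP) tr_nilp_sqr // addr0.
Qed.

Lemma torus_elt_exists d : d = 1 \/ d = -1 ->
  exists a b, [/\ a != 0, b != 0 & a ^+ 2 + b ^+ 2 * d = 1].
Proof.
have [t nt] := exists_not_inF3 q4.
have [t0 t1 tm1] : [/\ t != 0, t != 1 & t != -1].
  by split; apply/eqP => e; apply: nt; apply/inF3P; rewrite e;
    [apply: Or31|apply: Or32|apply: Or33].
have tp : 1 + t ^+ 2 != 0 by rewrite addrC addr_eq0 nsq.
have tm : 1 - t ^+ 2 != 0.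
  by rewrite subr_eq0 eq_sym sqrf_eq1 (negPf t1) (negPf tm1).
have n2 := two_neq0 two.
(* These are rational parametrizations of the conic a ^ 2 + d b ^ 2 = 1; taking t outside the prime
   field keeps both coordinates nonzero. *)
case=> ->.
  exists ((1 - t ^+ 2) / (1 + t ^+ 2)), (2 * t / (1 + t ^+ 2)).
  by split; rewrite ?mulf_neq0 ?invr_eq0 //; field.
exists ((1 + t ^+ 2) / (2 * t)), ((1 - t ^+ 2) / (2 * t)).
by split; rewrite ?mulf_neq0 ?invr_eq0 ?mulf_neq0 //; field; rewrite ?t0 ?n2.
Qed.

Lemma torus_sol_ex M : \tr M = 0 -> \det M = 1 \/ \det M = -1 ->
  exists g a b, [/\ g \in SL2 F, a != 0, b != 0, mat g = a%:A + b *: M & Sol g = torus_sol M].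
Proof.
move=> tM dM; have [a [b [a0 b0 e]]] := torus_elt_exists dM.
have dg : \det (a%:A + b *: M) = 1 by rewrite det_torus.
exists (of_mx (a%:A + b *: M)), a, b; split; rewrite ?of_mx_SL2 ?of_mxK //.
apply: (sol_torus (a := a) (b := b)); rewrite ?of_mxK //.
by case: dM => ->; rewrite ?oppr_eq0 oner_eq0.
Qed.

Lemma torus_solN M : \tr M = 0 -> \det M = 1 \/ \det M = -1 ->
  torus_sol (- M) = torus_sol M.
Proof.
move=> tM dM; have [g [a [b [gS a0 b0 Eg <-]]]] := torus_sol_ex tM dM.
apply/esym/(sol_torus (a := a) (b := - b)); rewrite ?oppr_eq0 //.
- by rewrite raddfN /= tM oppr0.
- by rewrite -scaleN1r detZ sqrrN expr1n mul1r; case: dM => ->; rewrite ?oppr_eq0 oner_eq0.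
- by move: gS; rewrite mem_SL2 => /eqP.
- by rewrite scaleNr scalerN opprK.
Qed.

(* A traceless M of determinant 1 labels two solvabilizers: that of the involution
   M, and (when the boolean is true) that of the generic elements of its torus. *)
Definition labelled_sol (k : bool * 'M[F]_2) : {set {'GL_2[F]}} :=
  let: (b, M) := k in
  if M == 0 then SL2 F : {set _} else if \det M == 0 then Sol (unip M)
  else if b || (\det M == -1) then torus_sol M else Sol (of_mx M).

Arguments labelled_sol : simpl never.

Definition labels : {set bool * 'M[F]_2} :=
  [set k | (\tr k.2 == 0) && ((\det k.2 == 1) || ~~ k.1 && ((\det k.2 == 0) || (\det k.2 == -1)))].

Variant label_spec : bool * 'M[F]_2 -> Type :=
| Label0 : label_spec (false, 0)
| LabelNil M of nilmx M & M != 0 : label_spec (false, M)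
| LabelInv M of \tr M = 0 & \det M = 1 : label_spec (false, M)
| LabelTorus (b : bool) M of \tr M = 0 & \det M = (if b then 1 else -1) : label_spec (b, M).

Lemma labelsP (k : bool * 'M[F]_2) : k \in labels -> label_spec k.
Proof.
case: k => b M; rewrite inE /= => /andP[/eqP tM].
case: eqP => [d1 _|_ /= /andP[]]; first by case: b; [apply: LabelTorus|apply: LabelInv].
case: b => //= _; case: eqP => [d0 _|_ /= /eqP dm]; last exact: LabelTorus.
by case: (eqVneq M 0) => [->|M0]; [apply: Label0|apply: LabelNil].
Qed.

Lemma det1_neq0 M : \det M = 1 -> M != 0.
Proof. by move=> d; apply/eqP => e; move/eqP: d; rewrite e det0 eq_sym oner_eq0. Qed.

Lemma detN1_neq0 M : \det M = -1 -> M != 0.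
Proof. by move=> d; apply/eqP => e; move/eqP: d; rewrite e det0 eq_sym oppr_eq0 oner_eq0. Qed.

Lemma one_neqN1 : (1 == -1 :> F) = false.
Proof. by apply/negP => /eqP e; have /eqP[] := nsq 1; rewrite expr1n. Qed.

Lemma labelled_sol0 : labelled_sol (false, 0) = SL2 F.
Proof. by rewrite /labelled_sol eqxx. Qed.

Lemma labelled_sol_nil M : nilmx M -> M != 0 -> labelled_sol (false, M) = Sol (unip M).
Proof. by case=> _ dM M0; rewrite /labelled_sol (negPf M0) dM eqxx. Qed.

Lemma labelled_sol_inv M : \det M = 1 -> labelled_sol (false, M) = Sol (of_mx M).
Proof. by move=> d; rewrite /labelled_sol (negPf (det1_neq0 d)) d oner_eq0 one_neqN1. Qed.

Lemma labelled_sol_torus (b : bool) M : \det M = (if b then 1 else -1) ->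
  labelled_sol (b, M) = torus_sol M.
Proof.
rewrite /labelled_sol; case: b => d; first by rewrite (negPf (det1_neq0 d)) d oner_eq0.
by rewrite (negPf (detN1_neq0 d)) d oppr_eq0 oner_eq0 eqxx.
Qed.

(** Single memberships involve prime field conditions; imposing them along the whole line F P leaves
    only orthogonality. A labelled solvabilizer thus determines which nilpotents are orthogonal to
    its matrix. *)
Lemma unip_multiples_labelled (k : bool * 'M[F]_2) P : k \in labels -> nilmx P ->
  (forall t, unip (t *: P) \in labelled_sol k) <-> \tr (P * k.2) = 0.
Proof.
move=> + nP; have nPt t := nilpZ t nP.
case/labelsP => [|M nM M0|M tM dM|b M tM dM] /=.
- by rewrite labelled_sol0 mulr0 mxtrace0; split=> // _ t; rewrite unip_SL2.
- rewrite labelled_sol_nil //; split=> [h|PM t].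
    apply: (inF3_multiples q4) => t; rewrite trM_comm -mxtraceZ scalerAr.
    exact: (unip_sol_unip two nsq nM (nPt t)).
  have [l ->] := tr_nilp_mul_eq0 two nM nP M0 (etrans (trM_comm _ _) PM).
  have nl := nilpZ (t * l) nM; rewrite scalerA.
  apply: (mem_sol_semicommute two (unip_SL2 nl) (proj1 nM) M0); exists 1; rewrite mat_unip //.
    by rewrite scale1r mulrDl mulrDr mul1r mulr1.
  by rewrite scale1r mulrDl mulrDr mul1r mulr1 -scalerAl -scalerAr.
- rewrite labelled_sol_inv //; split=> [h|/(tr_nilp_aniso nsq tM dM nP)-> t]; last first.
    rewrite scaler0 unip0; apply: sol_sym; first exact: group1.
    by rewrite sol_scalar ?group1 // of_mx_SL2.
  case: (eqVneq P 0) => [->|P0]; first by rewrite mul0r mxtrace0.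
  apply: (inF3_multiples q4) => t; case: (eqVneq t 0) => [->|t0].
    by rewrite mul0r; apply: inF3_0.
  apply: (inF3_sqr nsq); rewrite -mxtraceZ scalerAl.
  have tP0 : t *: P != 0 by rewrite scaler_eq0 negb_or t0.
  by have := (unip_sol_involution two nsq (nPt t) tP0 tM dM).1 (h t) => ->; apply: inF3_1.
have dM0 : \det M != 0 by rewrite dM; case: (b); rewrite ?oppr_eq0 oner_eq0.
rewrite labelled_sol_torus //; split=> [h|PM t].
  by have := h 1; rewrite scale1r => /(unip_torus nP tM dM0).
by apply/(unip_torus (nPt t) tM dM0); rewrite -scalerAl mxtraceZ PM mulr0.
Qed.
End Keys.
Arguments labelled_sol {F} k : simpl never.

(** * When two labels give the same solvabilizer *)

Section Bijection.
Local Open Scope ring_scope.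
Variable F : finFieldType.
Hypothesis two : 2 = -1 :> F.
Hypothesis nsq : forall a : F, a ^+ 2 != -1.
Hypothesis q4 : (4 < #|F|)%N.
Implicit Types (A B M N P X J : 'M[F]_2) (a b c d t : F) (g h x y z : {'GL_2[F]}).
Implicit Types (k : bool * 'M[F]_2).

Local Notation Sol := (solvabilizer (SL2 F)).

Lemma scale_pm c M : c ^+ 2 = 1 -> c *: M = M \/ c *: M = - M.
Proof.
move=> /eqP; rewrite sqrf_eq1 => /orP[] /eqP ->; rewrite ?scale1r ?scaleN1r; by [left|right].
Qed.

(** The nilpotents orthogonal to M determine it up to a factor c. As det M' = - c ^ 2 lies in the
    prime field and -1 is not a square, c ^ 2 = 1. *)
Lemma split_zero_set M M' : \tr M = 0 -> \tr M' = 0 -> \det M = -1 -> M' != 0 ->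
  (forall P, nilmx P -> \tr (P * M) = 0 -> \tr (P * M') = 0) ->
  inF3 (\det M') -> \det M' = -1 /\ (M' = M \/ M' = - M).
Proof.
move=> tM tM' dM M'0 Z sd; have M0 := detN1_neq0 dM.
have [c Ec] := traceless_comm two tM tM' M0 (tr_nilp_split_comm two tM dM Z).
move: sd M'0; rewrite Ec detZ dM mulrN1 => sd c0.
have c2 : c ^+ 2 = 1.
  have /inF3P[/eqP|//|/eqP] := inF3N sd; rewrite opprK ?(negPf (nsq c)) // sqrf_eq0.
  by move=> /eqP c00; rewrite c00 scale0r eqxx in c0.
by rewrite c2; split=> //; apply: scale_pm.
Qed.

(** Here M' = c M. A J with tr (M J) = 1 tests the scale: [unip M'] lies in its solvabilizer only if
    c ^ 2 = 1. *)
Lemma nil_labels M M' : nilmx M -> M != 0 -> nilmx M' -> M' != 0 ->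
  \tr (M * M') = 0 -> Sol (unip M) = Sol (unip M') -> M' = M \/ M' = - M.
Proof.
move=> nM M0 nM' M'0 MM' e; have [c Ec] := tr_nilp_mul_eq0 two nM nM' M0 MM'.
rewrite Ec; apply: scale_pm; have [J [tJ dJ MJ]] := nilp_tr1 nM M0.
have uJ : unip M \in Sol (of_mx J) by apply/(unip_sol_involution two) => //; rewrite MJ expr1n.
have : unip M' \in Sol (of_mx J).
  by apply: sol_sym; rewrite ?unip_SL2 // -e; apply: sol_sym; rewrite ?of_mx_SL2.
by move/(unip_sol_involution two nsq nM' M'0 tJ dJ); rewrite Ec -scalerAl mxtraceZ MJ mulr1.
Qed.

(** Scaling a nonzero nilpotent P so that tr (P J) = 1 and comparing memberships gives the
    hypothesis of [nilp_tr_sqr]. *)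
Lemma involution_labels J J' : \tr J = 0 -> \det J = 1 -> \tr J' = 0 -> \det J' = 1 ->
  Sol (of_mx J) = Sol (of_mx J') -> J' = J \/ J' = - J.
Proof.
move=> tJ dJ tJ' dJ' e; apply: (nilp_tr_sqr two q4) => // P nP.
case: (eqVneq P 0) => [->|P0]; first by rewrite !mul0r.
set t := \tr (P * J); have t0 : t != 0 by apply: contra_neq P0 => /(tr_nilp_aniso nsq tJ dJ nP).
have nQ := nilpZ t^-1 nP; have Q0 : t^-1 *: P != 0 by rewrite scaler_eq0 invr_eq0 negb_or t0.
have : unip (t^-1 *: P) \in Sol (of_mx J).
  by apply/(unip_sol_involution two) => //; rewrite -scalerAl mxtraceZ mulVf // expr1n.
rewrite e => /(unip_sol_involution two nsq nQ Q0 tJ' dJ').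
rewrite -scalerAl mxtraceZ exprMn exprVn => h; apply: (mulfI (invr_neq0 (expf_neq0 2 t0))).
by rewrite h mulVf // expf_neq0.
Qed.

(** A generic g of the torus of M lies in [torus_sol M']. No nonzero nilpotent is orthogonal to M',
    so g semicommutes with M'; having nonzero trace, it commutes with M', which is then proportional
    to M. *)
Lemma torus_labels M M' : \tr M = 0 -> \det M = 1 -> \tr M' = 0 -> \det M' = 1 ->
  torus_sol M = torus_sol M' -> M' = M \/ M' = - M.
Proof.
move=> tM dM tM' dM' e.
have [g [a [b [gS a0 b0 Eg Sg]]]] := torus_sol_ex two nsq q4 tM (or_introl dM).
have dM'0 : \det M' != 0 by rewrite dM' oner_eq0.
have : g \in torus_sol M' by rewrite -e -Sg mem_sol_id.
case/torus_solP=> _ [s|[P [nP P0 PM' _]]]; last first.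
  by rewrite (tr_nilp_aniso nsq tM' dM' nP PM') eqxx in P0.
have tg : \tr (mat g) != 0.
  by rewrite Eg mxtraceD tr_alg // mxtraceZ tM mulr0 addr0 oppr_eq0.
have MM' : M * M' = M' * M.
  apply: (scalerI b0); rewrite scalerAl scalerAr; apply: (addrI (a *: M')).
  have := semicommute_commute tM' dM'0 tg s.
  by rewrite Eg mulrDl mulrDr -[in a%:A * _]scalerAl -[in _ * a%:A]scalerAr mul1r mulr1.
have [c Ec] := traceless_comm two tM tM' (det1_neq0 dM) MM'.
by rewrite Ec; apply: scale_pm; move: dM'; rewrite Ec detZ dM mulr1.
Qed.

(** The solvabilizer of J contains a nontrivial unipotent element; [torus_sol M] contains none,
    since no nonzero nilpotent is orthogonal to M. *)
Lemma involution_torus J M : \tr J = 0 -> \det J = 1 -> \tr M = 0 -> \det M = 1 ->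
  Sol (of_mx J) <> torus_sol M.
Proof.
move=> tJ dJ tM dM e; pose P := mx2 0 1 0 0 : 'M[F]_2.
have nP : nilmx P by split; rewrite mx2E; ring.
have P0 : P != 0 by apply/eqP => /mul0mx2[_ /eqP]; rewrite oner_eq0.
set t := \tr (P * J); have t0 : t != 0 by apply: contra_neq P0 => /(tr_nilp_aniso nsq tJ dJ nP).
have nQ := nilpZ t^-1 nP; have Q0 : t^-1 *: P != 0 by rewrite scaler_eq0 invr_eq0 negb_or t0.
have : unip (t^-1 *: P) \in Sol (of_mx J).
  by apply/(unip_sol_involution two) => //; rewrite -scalerAl mxtraceZ mulVf // expr1n.
rewrite e => /(unip_torus two nQ tM); rewrite dM oner_eq0 => /(_ isT).
by move/(tr_nilp_aniso nsq tM dM nQ)/eqP; rewrite (negPf Q0).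
Qed.

(** The nilpotents orthogonal to the matrix of a label are all of them for 0, one line for a nonzero
    nilpotent, only 0 for determinant 1, two lines for determinant -1. This separates the cases; the
    preceding lemmas settle each one. *)
Lemma labelled_sol_inj k k' : k \in labels F -> k' \in labels F ->
  labelled_sol k = labelled_sol k' -> k' = k \/ k' = (k.1, - k.2).
Proof.
move=> kL kL' e.
have Z P : nilmx P -> \tr (P * k.2) = 0 <-> \tr (P * k'.2) = 0.
  move=> nP; rewrite -(unip_multiples_labelled two nsq q4 kL nP) e.
  exact: unip_multiples_labelled.
have pm (b : bool) M M' : M' = M \/ M' = - M -> (b, M') = (b, M) \/ (b, M') = (b, - M).
  by case=> ->; [left|right].
have p_1 := @inF3_1 F; have p_0 := @inF3_0 F; have p_N1 := inF3N p_1.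
have N11 : -1 = 1 :> F -> False by move/esym/eqP; rewrite (one_neqN1 nsq).
have N10 : -1 = 0 :> F -> False by move/eqP; rewrite oppr_eq0 oner_eq0.
have zero M : \tr M = 0 -> M != 0 -> (forall P, nilmx P -> \tr (P * M) = 0) -> False.
  by move=> tM /eqP M0 /(tr_nilp_test0 two tM).
have vanish M M' : nilmx M -> M != 0 -> \tr M' = 0 -> \det M' = 1 -> \tr (M * M') = 0 -> False.
  by move=> nM M0 tM' dM' /(tr_nilp_aniso nsq tM' dM' nM)/eqP; rewrite (negPf M0).
have n0 := @det1_neq0 F; have nN0 := @detN1_neq0 F.
have d0 M : nilmx M -> \det M = 0 by case.
have t0 M : nilmx M -> \tr M = 0 by case.
have sq0 := @tr_nilp_sqr F.
have split M M' : \tr M = 0 -> \tr M' = 0 -> \det M = -1 -> M' != 0 ->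
    (forall P, nilmx P -> \tr (P * M) = 0 <-> \tr (P * M') = 0) ->
    inF3 (\det M') -> \det M' = -1 /\ (M' = M \/ M' = - M).
  by move=> tM tM' dM M'0 ZM; apply: split_zero_set => // P /ZM[].
have tr0 P : \tr (P * 0) = 0 by rewrite mulr0 mxtrace0.
move: e Z; case: (labelsP kL) => [|M nM M0|M tM dM|[] M tM dM] e Z.
- case: (labelsP kL') e Z => [|M' nM' M'0|M' tM' dM'|[] M' tM' dM'] e Z; rewrite /= in Z *.
  + by left.
  + by case: (zero M' (t0 M' nM') M'0) => P nP; apply/(Z P nP)/tr0.
  + by case: (zero M' tM' (n0 M' dM')) => P nP; apply/(Z P nP)/tr0.
  + by case: (zero M' tM' (n0 M' dM')) => P nP; apply/(Z P nP)/tr0.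
  + by case: (zero M' tM' (nN0 M' dM')) => P nP; apply/(Z P nP)/tr0.
- case: (labelsP kL') e Z => [|M' nM' M'0|M' tM' dM'|[] M' tM' dM'] e Z; rewrite /= in Z *.
  + by case: (zero M (t0 M nM) M0) => P nP; apply/(Z P nP)/tr0.
  + rewrite !labelled_sol_nil // in e; apply: pm.
    exact: (nil_labels nM M0 nM' M'0 ((Z M nM).1 (sq0 M nM)) e).
  + by case: (vanish M M' nM M0 tM' dM' ((Z M nM).1 (sq0 M nM))).
  + by case: (vanish M M' nM M0 tM' dM' ((Z M nM).1 (sq0 M nM))).
  + have [|] := split M' M tM' (t0 M nM) dM' M0 (fun P nP => iff_sym (Z P nP));
      by rewrite d0 // => /esym/N10.
- case: (labelsP kL') e Z => [|M' nM' M'0|M' tM' dM'|[] M' tM' dM'] e Z; rewrite /= in Z *.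
  + by case: (zero M tM (n0 M dM)) => P nP; apply/(Z P nP)/tr0.
  + by case: (vanish M' M nM' M'0 tM dM); rewrite (Z M' nM').2 ?sq0.
  + by apply: pm; apply: involution_labels => //; move: e; rewrite !labelled_sol_inv.
  + case: (@involution_torus M M') => //.
    by move: e; rewrite labelled_sol_inv // labelled_sol_torus.
  + have [|] := split M' M tM' tM dM' (n0 M dM) (fun P nP => iff_sym (Z P nP));
      by rewrite dM // => /esym/N11.
- case: (labelsP kL') e Z => [|M' nM' M'0|M' tM' dM'|[] M' tM' dM'] e Z; rewrite /= in Z *.
  + by case: (zero M tM (n0 M dM)) => P nP; apply/(Z P nP)/tr0.
  + by case: (vanish M' M nM' M'0 tM dM); rewrite (Z M' nM').2 ?sq0.
  + case: (@involution_torus M' M) => //.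
    by move: e; rewrite labelled_sol_inv // labelled_sol_torus.
  + by apply: pm; apply: torus_labels => //; move: e; rewrite !labelled_sol_torus.
  + have [|] := split M' M tM' tM dM' (n0 M dM) (fun P nP => iff_sym (Z P nP));
      by rewrite dM // => /esym/N11.
- case: (labelsP kL') e Z => [|M' nM' M'0|M' tM' dM'|[] M' tM' dM'] e Z; rewrite /= in Z *.
  + by case: (zero M tM (nN0 M dM)) => P nP; apply/(Z P nP)/tr0.
  + by have [|] := split M M' tM (t0 M' nM') dM M'0 Z; rewrite d0 // => /esym/N10.
  + by have [|] := split M M' tM tM' dM (n0 M' dM') Z; rewrite dM' // => /esym/N11.
  + by have [|] := split M M' tM tM' dM (n0 M' dM') Z; rewrite dM' // => /esym/N11.
  + by have [|_] := split M M' tM tM' dM (nN0 M' dM') Z; rewrite ?dM' //; apply: pm.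
Qed.

Lemma of_mx_opp M : \tr M = 0 -> \det M = 1 -> of_mx (- M) = ((of_mx M)^-1)%g.
Proof.
move=> tM dM; apply/eqP; rewrite eq_sym eq_invg_mul; apply/eqP/mat_inj.
rewrite matM !of_mxK ?mulrN ?sqr_traceless // ?dM ?scaleN1r ?opprK //.
by rewrite -scaleN1r detZ sqrrN expr1n mul1r.
Qed.

Lemma unip_opp M : nilmx M -> unip (- M) = ((unip M)^-1)%g.
Proof.
move=> nM; apply/eqP; rewrite eq_sym eq_invg_mul; apply/eqP/mat_inj.
have nN : nilmx (- M) by rewrite -scaleN1r; apply: nilpZ.
rewrite matM !mat_unip // mulrDl mul1r mulrDr mulr1 mulrN sqr_traceless ?(proj1 nM) //.
by rewrite (proj2 nM) oppr0 scale0r subr0 subrK.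
Qed.

Lemma labels_opp k : k \in labels F -> (k.1, - k.2) \in labels F.
Proof.
have dN M : \det (- M) = \det M by rewrite -scaleN1r detZ sqrrN expr1n mul1r.
by rewrite !inE /= dN raddfN oppr_eq0.
Qed.

Lemma labelled_sol_opp k : k \in labels F -> labelled_sol (k.1, - k.2) = labelled_sol k.
Proof.
have dN M : \det (- M) = \det M by rewrite -scaleN1r detZ sqrrN expr1n mul1r.
case/labelsP => [|M nM M0|M tM dM|b M tM dM] /=.
- by rewrite oppr0.
- rewrite !labelled_sol_nil ?oppr_eq0 // ?unip_opp ?solvabilizerV //.
  by rewrite -scaleN1r; apply: nilpZ.
- by rewrite !labelled_sol_inv ?dN // of_mx_opp // solvabilizerV.
- rewrite !labelled_sol_torus ?dN // (torus_solN two nsq q4) // dM.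
  by case: (b); [left|right].
Qed.
End Bijection.

(** The fibre through x is {x, s x}: its size plus its number of fixed points of s is always 2. *)
Lemma card_imset_pairs (T T' : finType) (f : T -> T') (s : T -> T) (D : {set T}) :
  (forall x, x \in D -> s x \in D /\ f (s x) = f x) ->
  (forall x y, x \in D -> y \in D -> f x = f y -> y = x \/ y = s x) ->
  (2 * #|f @: D| = #|D| + #|[set x in D | s x == x]|)%N.
Proof.
move=> sD fD.
have fib y : y \in f @: D ->
    (2 = #|[set x in D | f x == y]| + #|[set x in D | (s x == x) && (f x == y)]|)%N.
  case/imsetP=> x xD ->; have [sxD fsx] := sD x xD.
  have -> : [set z in D | f z == f x] = [set x; s x].
    apply/setP => z; rewrite !inE; apply/andP/orP => [[zD /eqP fz]|].
      by case: (fD x z xD zD (esym fz)) => ->; rewrite eqxx; [left|right].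
    by case=> /eqP ->; rewrite ?xD ?sxD ?fsx.
  case: (eqVneq (s x) x) => [sx|nsx].
    rewrite sx setUid cards1 (_ : [set z in D | _] = [set x]) ?cards1 //.
    apply/setP => z; rewrite !inE; apply/and3P/eqP => [[zD _ /eqP fz]|->]; last by rewrite xD sx.
    by case: (fD x z xD zD (esym fz)) => ->.
  rewrite cards2 eq_sym nsx (_ : [set z in D | _] = set0) ?cards0 //.
  apply/setP => z; rewrite !inE; apply/negP => /and3P[zD /eqP sz /eqP fz].
  case: (fD x z xD zD (esym fz)) => Ez; first by rewrite -Ez sz eqxx in nsx.
  case: (fD z x zD xD fz) => Ex; first by rewrite -Ez Ex eqxx in nsx.
  by rewrite -Ez Ex sz eqxx in nsx.
rewrite mulnC -sum_nat_const (eq_bigr _ fib) big_split /=; congr (_ + _)%N.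
  rewrite -sum1_card (partition_big_imset f) /=; apply: eq_bigr => y _.
  by rewrite -sum1_card; apply: eq_bigl => x; rewrite inE.
rewrite -[RHS]sum1_card (partition_big f [in f @: D]) /=; last first.
  by move=> x; rewrite inE => /andP[xD _]; apply: imset_f.
by apply: eq_bigr => y _; rewrite -sum1_card; apply: eq_bigl => x; rewrite !inE andbA.
Qed.

(** * The labels exhaust the solvabilizers *)

Section Surjection.
Local Open Scope ring_scope.
Variable F : finFieldType.
Hypothesis two : 2 = -1 :> F.
Hypothesis nsq : forall a : F, a ^+ 2 != -1.
Hypothesis q4 : (4 < #|F|)%N.
Variable m : nat.
Hypothesis q_mod4 : #|F| = (4 * m + 3)%N.
Implicit Types (M N P J : 'M[F]_2) (a b c d t : F) (g h x y z : {'GL_2[F]}).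
Implicit Types (k : bool * 'M[F]_2).

Local Notation Sol := (solvabilizer (SL2 F)).

Lemma sqr_or_opp a : exists b, b ^+ 2 = a \/ b ^+ 2 = - a.
Proof.
(* As q = 4 m + 3, (b ^ 2) ^ 2 = a ^ (q + 1) = a ^ 2. *)
exists (a ^+ m.+1); apply/pred2P; rewrite /= -eqf_sqr -!exprM.
apply/eqP; transitivity (a ^+ #|F| * a); last by rewrite expf_card.
by rewrite -exprSr q_mod4; congr (_ ^+ _); lia.
Qed.

Lemma labelled_sol_exists k : k \in labels F -> exists2 g, g \in SL2 F & labelled_sol k = Sol g.
Proof.
case/labelsP => [|M nM M0|M tM dM|b M tM dM].
- by exists 1%g; rewrite ?group1 // labelled_sol0 sol_scalar ?group1.
- by exists (unip M); rewrite ?unip_SL2 // labelled_sol_nil.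
- by exists (of_mx M); rewrite ?of_mx_SL2 // labelled_sol_inv.
have [|g [_ [_ [gS _ _ _ eg]]]] := @torus_sol_ex _ two nsq q4 M tM.
  by rewrite dM; case: (b); [left|right].
by exists g; rewrite // labelled_sol_torus.
Qed.

Lemma sol_opp g h : mat h = - mat g -> Sol g = Sol h.
Proof.
move=> e; apply: sol_coset; apply/rcoset_kercosetP; rewrite ?norm_scalars //.
apply/rcosetP; exists (of_mx (-1)); last first.
  by apply: mat_inj; rewrite matM of_mxK ?e ?mulrNN ?mul1r // mx2_1 !mx2E; ring.
apply/scalarsP; exists (-1); rewrite of_mxK ?scaleN1r // mx2_1 !mx2E; ring.
Qed.

(** Write g = -t + N with N traceless, so det N = 1 - t ^ 2. Then g is scalar if N = 0, unipotent up
    to sign if only det N = 0, an involution modulo scalars if t = 0, and otherwise generic in the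
    torus of N. *)
Lemma sol_labelled g : g \in SL2 F -> exists2 k, k \in labels F & Sol g = labelled_sol k.
Proof.
rewrite mem_SL2 => /eqP dg; pose N := mat g + (\tr (mat g))%:A; set t := \tr (mat g) in N.
have tN : \tr N = 0 by apply: tracelessD.
have Eg : mat g = (- t)%:A + N by rewrite addrCA scaleNr addNr addr0.
have dN : \det N = 1 - t ^+ 2.
  have := det_torus (- t) 1 tN; rewrite scale1r -Eg dg sqrrN expr1n mul1r => ->.
  by rewrite addrC addKr.
clearbody N; case: (eqVneq N 0) => [N0|N0].
  exists (false, 0); first by rewrite inE /= mxtrace0 det0 !eqxx orbT.
  by rewrite labelled_sol0 sol_scalar //; apply/scalarsP; exists (- t); rewrite Eg N0 addr0.
case: (eqVneq (\det N) 0) => [d0|d0].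
  have nN : nilmx N by [].
  have nN' : nilmx (- N) by rewrite -scaleN1r; apply: nilpZ.
  have /pred2P : (t == 1) || (t == -1).
    by rewrite -sqrf_eq1 eq_sym -subr_eq0 -dN d0.
  case=> Et.
    exists (false, - N); first by rewrite inE /= (proj1 nN') (proj2 nN') !eqxx orbT.
    rewrite labelled_sol_nil ?oppr_eq0 //; apply: sol_opp.
    by rewrite mat_unip // Eg Et scaleN1r opprD opprK.
  exists (false, N); first by rewrite inE /= (proj1 nN) d0 !eqxx orbT.
  rewrite labelled_sol_nil //; congr (Sol _); apply: mat_inj.
  by rewrite mat_unip // Eg Et opprK scale1r.
case: (eqVneq t 0) => [t0|t0].
  have dN1 : \det N = 1 by rewrite dN t0 expr0n subr0.
  exists (false, N); first by rewrite inE /= tN dN1 !eqxx.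
  rewrite labelled_sol_inv //; congr (Sol _); apply: mat_inj.
  by rewrite of_mxK // Eg t0 oppr0 scale0r add0r.
(* Dividing N by e normalizes its determinant to 1 or -1. *)
have [e eN] := sqr_or_opp (\det N).
have e0 : e != 0.
  apply: contra_neq d0 => e0; move: eN; rewrite e0 expr0n /= => -[<- //|/esym/eqP].
  by rewrite oppr_eq0 => /eqP.
have tM : \tr (e^-1 *: N) = 0 by rewrite mxtraceZ tN mulr0.
have EM : mat g = (- t)%:A + e *: (e^-1 *: N) by rewrite scalerA divff // scale1r.
have dM : \det (e^-1 *: N) = e ^- 2 * \det N by rewrite detZ exprVn.
case: eN => eN.
  have d1 : \det (e^-1 *: N) = 1 by rewrite dM -eN mulVf // expf_neq0.
  exists (true, e^-1 *: N); first by rewrite inE /= tM d1 !eqxx.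
  rewrite labelled_sol_torus //; apply: (sol_torus two nsq tM _ _ e0 dg EM); rewrite ?oppr_eq0 //.
  by rewrite d1 oner_eq0.
have d1 : \det (e^-1 *: N) = -1 by rewrite dM -[\det N]opprK -eN mulrN mulVf // expf_neq0.
exists (false, e^-1 *: N); first by rewrite inE /= tM d1 !eqxx !orbT.
rewrite labelled_sol_torus //; apply: (sol_torus two nsq tM _ _ e0 dg EM); rewrite ?oppr_eq0 //.
by rewrite d1 oppr_eq0 oner_eq0.
Qed.

Lemma Solv_SL2 : Solv (SL2 F) = @labelled_sol F @: labels F.
Proof.
apply/setP => X; apply/imsetP/imsetP => [[g gS ->]|[k kL ->]].
  by have [k kL e] := sol_labelled gS; exists k.
by have [g gS e] := labelled_sol_exists kL; exists g.
Qed.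

(** The fibres of [labelled_sol] are the orbits of M |-> -M, whose only fixed label is (false,
    0). *)
Lemma card_Solv_SL2 : (2 * #|Solv (SL2 F)| = #|labels F| + 1)%N.
Proof.
rewrite Solv_SL2 (@card_imset_pairs _ _ _ (fun k => (k.1, - k.2))).
- congr (_ + _)%N; rewrite -[RHS](cards1 (false, 0 : 'M[F]_2)); apply: eq_card => -[b M].
  rewrite in_set1 inE; apply/andP/eqP => [[bL /eqP[e]]|[-> ->]]; last first.
    by rewrite inE /= mxtrace0 det0 oppr0 !eqxx !orbT.
  have M0 : M = 0.
    apply/matrixP => i j; rewrite [RHS]mxE; apply: (eq0_double two).
    by move/matrixP/(_ i j): e; rewrite mxE => {2}<-; rewrite subrr.
  by move: bL; rewrite M0 inE /= det0 [0 == 1]eq_sym oner_eq0 /= => /and3P[_ /negPf -> _].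
- by move=> k kL; rewrite labels_opp // labelled_sol_opp.
- by move=> k k'; apply: labelled_sol_inj.
Qed.
End Surjection.

(** * Counting *)

Section Counting.
Local Open Scope ring_scope.
Variable F : finFieldType.
Hypothesis two : 2 = -1 :> F.
Hypothesis nsq : forall a : F, a ^+ 2 != -1.
Implicit Types (M : 'M[F]_2) (a b c d x y z : F).

Local Notation q := #|F|.

(** Each nonzero y admits one z; y = 0 admits all of them if c = 0 and none otherwise. *)
Lemma card_mul_eq c :
  (\sum_(y : F) \sum_(z : F) ((y * z)%R == c) = q.-1 + (c == 0%R) * q)%N.
Proof.
rewrite (bigD1 0) //= addnC; congr (_ + _)%N; last first.
  rewrite (eq_bigr (fun=> (c == 0) : nat)) => [|z _]; last by rewrite mul0r eq_sym.
  by rewrite sum_nat_const mulnC.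
rewrite (eq_bigr (fun=> 1%N)) => [|y y0].
  by rewrite sum1_card -(cardC1 (0 : F)).
rewrite (bigD1 (y^-1 * c)) //= mulrA divff // mul1r eqxx big1 // => z.
by apply: contraNeq; rewrite eqb0 negbK => /eqP <-; rewrite mulKf.
Qed.

Definition traceless_det d : {set 'M[F]_2} := [set M | (\tr M == 0) && (\det M == d)].

(** With diagonal x, -x the condition reads y z = - d - x ^ 2; the second term comes from the x
    making the right side vanish. *)
Lemma card_traceless_det d :
  (#|traceless_det d| = q * q.-1 + #|[set x : F | (x ^+ 2 == - d)%R]| * q)%N.
Proof.
pose f (u : F * F * F) := mx2 u.1.1 u.1.2 u.2 (- u.1.1).
have f_inj : injective f by move=> [[x y] z] [[x' y'] z'] /mx2_inj /= [-> -> ->].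
have -> : traceless_det d = f @: [set u | u.1.2 * u.2 == - d - u.1.1 ^+ 2].
  apply/setP => M; rewrite inE; apply/andP/imsetP => [[/eqP/traceless_mx2P[x [y [z ->]]]]|].
    rewrite mx2E => /eqP <-; exists (x, y, z) => //; rewrite inE /=; apply/eqP; ring.
  case=> -[[x y] z]; rewrite inE /= => /eqP e ->.
  rewrite /f !mx2E /= subrr eqxx e; split=> //; apply/eqP; ring.
rewrite card_imset // -sum1_card big_mkcond /=.
rewrite (eq_bigr (fun u : F * F * F => (u.1.2 * u.2 == - d - u.1.1 ^+ 2) : nat)); last first.
  by move=> u _; rewrite inE; case: eqP.
rewrite -(pair_bigA _ (fun xy z => (xy.2 * z == - d - xy.1 ^+ 2) : nat)) /=.
rewrite -(pair_bigA _ (fun x y => \sum_(z : F) ((y * z)%R == (- d - x ^+ 2)%R))%N) /=.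
under eq_bigr do rewrite card_mul_eq.
rewrite big_split /= sum_nat_const; congr (_ + _)%N.
rewrite -big_distrl /=; congr (_ * _)%N.
rewrite -sum1_card [RHS]big_mkcond; apply: eq_bigr => x _.
by rewrite inE subr_eq0 eq_sym; case: eqP.
Qed.

(** Four fibres of the determinant are counted, for d = 1, 1, 0 and -1, where -d has 0, 0, 1 and 2
    square roots. *)
Lemma card_labels : (#|labels F| = 4 * (q * q.-1) + 3 * q)%N.
Proof.
have tE d : #|traceless_det d| = (\sum_(M : 'M[F]_2) ((\tr M == 0%R) && (\det M == d)))%N.
  by rewrite -sum1_card big_mkcond; apply: eq_bigr => M _; rewrite inE; case: (_ && _).
have -> : #|labels F| = (#|traceless_det 1%R| +
    (#|traceless_det 1%R| + #|traceless_det 0%R| + #|traceless_det (-1)%R|))%N.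
  rewrite -sum1_card big_mkcond /=.
  rewrite (eq_bigr (fun k : bool * 'M[F]_2 => ((k.1, k.2) \in labels F) : nat)); last first.
    by move=> [b M] _; case: (_ \in _).
  rewrite -(pair_bigA _ (fun (b : bool) M => ((b, M) \in labels F) : nat)) /= big_bool.
  congr (_ + _)%N.
    by rewrite tE; apply: eq_bigr => M _; rewrite !inE /= orbF.
  rewrite !tE -!big_split /=.
  apply: eq_bigr => M _; rewrite !inE /=; case: (\tr M == 0) => //=.
  have n10 : (1 == 0 :> F) = false by rewrite oner_eq0.
  have nm0 : (-1 == 0 :> F) = false by rewrite oppr_eq0 oner_eq0.
  have n1m := one_neqN1 nsq.
  case: (eqVneq (\det M) 1) => [->|_] /=; first by rewrite n10 n1m.
  case: (eqVneq (\det M) 0) => [->|_] /=; first by rewrite eq_sym nm0.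
  by case: (_ == -1).
rewrite !card_traceless_det.
have -> : #|[set x : F | x ^+ 2 == -1]| = 0%N.
  by apply/eqP; rewrite cards_eq0; apply/eqP/setP => x; rewrite !inE (negPf (nsq x)).
have -> : #|[set x : F | x ^+ 2 == - 0]| = 1%N.
  by rewrite -[RHS](cards1 (0 : F)); apply: eq_card => x; rewrite !inE oppr0 sqrf_eq0.
have -> : #|[set x : F | x ^+ 2 == - -1]| = 2%N.
  rewrite -[RHS](_ : #|[set 1; -1 : F]| = 2%N); last by rewrite cards2 (one_neqN1 nsq).
  by apply: eq_card => x; rewrite !inE opprK sqrf_eq1.
lia.
Qed.
End Counting.

(** * Passage to the quotient by the center *)

Section Quotient.
Local Open Scope group_scope.

(** Solvabilizers are unions of cosets of the center and map onto those of the quotient, so distinct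
    ones have distinct images. *)
Lemma card_Solv_quotient_center (gT : finGroupType) (G : {group gT}) :
  #|Solv (G / 'Z(G))| = #|Solv G|.
Proof.
have nZ x : x \in G -> x \in 'N('Z(G)).
  by apply: (subsetP (normal_norm (center_normal G))).
have solE x y : x \in G -> y \in G ->
    solvable <<[set coset 'Z(G) x; coset 'Z(G) y]>> = solvable <<[set x; y]>>.
  move=> xG yG; rewrite -quotient_gen2 ?nZ //; apply: quotient_abelian_sol.
    exact: center_abelian.
  by rewrite gen_subG subUset !sub1set !nZ.
have imE x : x \in G ->
    solvabilizer (G / 'Z(G)) (coset 'Z(G) x) = solvabilizer G x / 'Z(G).
  move=> xG; apply/setP => Y; rewrite inE; apply/andP/morphimP => [[]|[y _ + ->]].
    case/morphimP=> y yN yG -> sol; exists y => //.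
    by rewrite inE yG -(solE x y xG yG).
  by rewrite inE => /andP[yG sol]; rewrite mem_quotient // solE.
have preE x y : x \in G -> y \in G ->
    (coset 'Z(G) y \in solvabilizer G x / 'Z(G)) = (y \in solvabilizer G x).
  by move=> xG yG; rewrite -imE // !inE mem_quotient // solE // yG.
have -> : Solv (G / 'Z(G)) = (fun A : {set gT} => A / 'Z(G)) @: Solv G.
  apply/setP => A; apply/imsetP/imsetP => [[X /morphimP[x xN xG ->] ->]|[B /imsetP[x xG ->] ->]].
    by exists (solvabilizer G x); rewrite ?imset_f //; apply: imE.
  by exists (coset 'Z(G) x); rewrite ?mem_quotient // imE.
rewrite card_in_imset // => A B /imsetP[x xG ->] /imsetP[y yG ->] e.
apply/setP => z; case: (boolP (z \in G)) => zG; last by rewrite !inE (negPf zG).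
by rewrite -!preE // e.
Qed.
End Quotient.

Theorem theorem3p8 (p : nat) (F : finFieldType) :
  prime p -> odd p -> #|F| = 3 ^ p ->
  2 * #|Solv (PSL2 F)| = 4 * (3 ^ p) ^ 2 - 3 ^ p + 1.
Proof.
move=> p_pr p_odd cardF.
have p3 : (2 < p)%N by apply: odd_prime_gt2.
have two : (2 = -1 :> F)%R.
  have /andP[_ /eqP c3] := card_finPcharP cardF (isT : prime 3).
  by apply/eqP; rewrite -addr_eq0 -mulrSr c3.
have q27 : 27 <= #|F| by rewrite cardF; apply: (@leq_pexp2l 3 3 p).
have [m qm] : exists m, #|F| = 4 * m + 3.
  (* For odd p, 3 ^ p is 3 times a power of 9, hence 3 modulo 4. *)
  exists (#|F| %/ 4); rewrite mulnC {1}(divn_eq #|F| 4); congr (_ + _).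
  rewrite cardF -(odd_double_half p) p_odd add1n expnS -mul2n expnM -modnMmr -modnXm.
  by rewrite exp1n.
have nsq (a : F) : (a ^+ 2 != -1)%R.
  (* If a ^ 2 = -1, then a = a ^ q = a ^ 3 = -a, so a = 0. *)
  apply/eqP => a2; have := expf_card a.
  rewrite qm exprD exprM (exprM a 2 2) a2 sqrrN !expr1n mul1r exprS a2 mulrN1 => /esym/eqP.
  rewrite -addr_eq0 => /eqP/(eq0_double two) a0.
  by move/eqP: a2; rewrite a0 expr0n eq_sym oppr_eq0 oner_eq0.
rewrite card_Solv_quotient_center (card_Solv_SL2 two nsq _ qm); last exact: leq_trans q27.
(* For q > 0 the truncated subtractions are exact, and 4 q (q - 1) + 3 q + 1 = 4 q ^ 2 - q + 1. *)
rewrite (card_labels nsq) -cardF; move: q27; case: #|F| => // n _; nia.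
Qed.
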